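(* Let $\mathcal{C}$ be a pretannakian category over an algebraically closed field $\mathbf{k}$ and let $X\in\mathcal{C}$. Then $$\dim_{\mathbf{k}}\mathrm{Hom}(X,\mathbf{1})\;\le\;\mathrm{sgd}(X).$$ Furthermore, the following properties of $X$ are equivalent: (1) $\dim_{\mathbf{k}}\mathrm{Hom}(X,\mathbf{1})=\mathrm{sgd}(X)$; (2) for every tensor functor $F:\mathcal{C}\to\mathcal{C}'$ to a pretannakian category $\mathcal{C}'$ we have $\dim_{\mathbf{k}}\mathrm{Hom}(FX,\mathbf{1})=\mathrm{sgd}(X)$ (so in particular every such $F$ yields an isomorphism $\mathrm{Hom}(X,\mathbf{1})\to\mathrm{Hom}(FX,\mathbf{1})$); (3) the image of $\mathrm{Sym}(\widetilde{X})\to\mathrm{Sym}(X)$ is finite.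
   Context: A tensor category over $\mathbf{k}$ is an essentially small $\mathbf{k}$-linear symmetric monoidal category $(\mathcal{C},\otimes,\mathbf{1})$ that is abelian, rigid, and for which $\mathbf{k}\to \mathrm{End}(\mathbf{1})$ is an isomorphism. It is pretannakian if moreover every object has finite length; $\ell(X)$ denotes the length of $X$. A tensor functor is a $\mathbf{k}$-linear exact symmetric monoidal functor. For an object $X$, $\mathrm{Sym}^nX$ is the object of $S_n$-coinvariants of $X^{\otimes n}$, $\mathrm{Sym}(X)=\bigoplus_{n\ge 0}\mathrm{Sym}^nX$ is the symmetric algebra in the ind-completion $\mathrm{Ind}\,\mathcal{C}$, and $\mathrm{Sym}^{\le n}X=\bigoplus_{i\le n}\mathrm{Sym}^iX$. An object of $\mathrm{Ind}\,\mathcal{C}$ is finite if it has finite length, i.e. belongs to $\mathcal{C}$. The symmetric growth dimension of $X$ is $$\mathrm{sgd}(X)=\limsup_{n\to\infty}\frac{\log(\ell(\mathrm{Sym}^{\le n}X))}{\log(n)}\in[0,+\infty].$$ For $X\in\mathcal{C}$, $\widetilde{X}\subset X$ is the kernel of the canonical epimorphism $X\to\mathrm{Hom}(X,\mathbf{1})^*\otimes\mathbf{1}$. *)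

(* Defs.v *)
From mathcomp Require Import all_boot all_order all_algebra.
From mathcomp Require Import perm.
From mathcomp Require Import boolp classical_sets functions reals constructive_ereal ereal.
From mathcomp Require Import exp sequences.

Set Implicit Arguments.
Unset Strict Implicit.
Unset Printing Implicit Defensive.

Import Order.TTheory GRing.Theory Num.Theory.
Local Open Scope ring_scope.

Declare Scope cat_scope.
Delimit Scope cat_scope with cat.
Local Open Scope cat_scope.

Reserved Notation "g ∘ f" (at level 40, left associativity).
Reserved Notation "X ⊗ Y" (at level 38, left associativity).
Reserved Notation "f ⊠ g" (at level 38, left associativity).
Reserved Notation "X ⊕ Y" (at level 39, left associativity).

(** * Linear algebra *)

Section LinearAlgebra.
Variables (k : fieldType) (V : lmodType k).

Definition lin_indep n (e : 'I_n -> V) : Prop :=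
  forall c : 'I_n -> k, \sum_(i < n) c i *: e i = 0 -> forall i, c i = 0.

Definition is_basis n (e : 'I_n -> V) : Prop :=
  lin_indep e /\ forall v, exists c : 'I_n -> k, v = \sum_(i < n) c i *: e i.

(* The dimension as an extended real, +oo in the infinite-dimensional case. *)
Definition dimk (R : realType) : \bar R :=
  ereal_sup [set (n%:R)%:E | n in [set n | exists e : 'I_n -> V, lin_indep e]].

End LinearAlgebra.

(** * Linear and abelian categories *)

(* The objects form a type, which is small relative to a larger universe, so
   there is no separate condition of essential smallness.  Structure such as
   (co)kernels, biproducts and tensor data is carried as chosen data;
   its existence and the possibility of choosing it are classically equivalent. *)
Record linear_category (k : fieldType) := LinearCategory {
  obj :> Type;
  Mor : obj -> obj -> lmodType k;
  idm : forall X, Mor X X;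
  cmp : forall X Y Z, Mor Y Z -> Mor X Y -> Mor X Z;
  comp1m : forall X Y (f : Mor X Y), cmp (idm Y) f = f;
  compm1 : forall X Y (f : Mor X Y), cmp f (idm X) = f;
  compA : forall X Y Z W (h : Mor Z W) (g : Mor Y Z) (f : Mor X Y),
    cmp h (cmp g f) = cmp (cmp h g) f;
  comp_linear_r : forall X Y Z (g : Mor Y Z), linear (fun f : Mor X Y => cmp g f);
  comp_linear_l : forall X Y Z (f : Mor X Y), linear (fun g : Mor Y Z => cmp g f)
}.
Arguments Mor {k l} X Y.
Arguments idm {k l} X.
Arguments cmp {k l X Y Z} g f.
Notation "g ∘ f" := (cmp g f) : cat_scope.

Section Morphisms.
Variables (k : fieldType) (C : linear_category k).

Definition is_mono (X Y : C) (f : Mor X Y) : Prop :=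
  forall Z (u v : Mor Z X), f ∘ u = f ∘ v -> u = v.

Definition is_epi (X Y : C) (f : Mor X Y) : Prop :=
  forall Z (u v : Mor Y Z), u ∘ f = v ∘ f -> u = v.

Definition is_iso (X Y : C) (f : Mor X Y) : Prop :=
  exists g : Mor Y X, g ∘ f = idm X /\ f ∘ g = idm Y.

Definition is_zero (X : C) : Prop := idm X = 0.

Definition is_simple (X : C) : Prop :=
  ~ is_zero X /\ forall Y (f : Mor Y X), is_mono f -> is_zero Y \/ is_iso f.

Definition short_exact (X Y Z : C) (i : Mor X Y) (p : Mor Y Z) : Prop :=
  [/\ is_mono i, is_epi p, p ∘ i = 0 &
      forall W (g : Mor W Y), p ∘ g = 0 -> exists h : Mor W X, i ∘ h = g].

(* [has_length X n]: X has a composition series with n simple subquotients. *)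
Inductive has_length : C -> nat -> Prop :=
| has_length0 X : is_zero X -> has_length X 0
| has_lengthS X Y Z n (i : Mor X Y) (p : Mor Y Z) :
    short_exact i p -> is_simple Z -> has_length X n -> has_length Y n.+1.

End Morphisms.

Record abelian_category (k : fieldType) := AbelianCategory {
  ab_lin :> linear_category k;
  zobj : ab_lin;
  zobj0 : is_zero zobj;
  bip : ab_lin -> ab_lin -> ab_lin;
  inl_ : forall X Y, Mor X (bip X Y);
  inr_ : forall X Y, Mor Y (bip X Y);
  prl_ : forall X Y, Mor (bip X Y) X;
  prr_ : forall X Y, Mor (bip X Y) Y;
  prl_inl : forall X Y, prl_ X Y ∘ inl_ X Y = idm X;
  prr_inr : forall X Y, prr_ X Y ∘ inr_ X Y = idm Y;
  bip_id : forall X Y,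
    inl_ X Y ∘ prl_ X Y + inr_ X Y ∘ prr_ X Y = idm (bip X Y);
  ker : forall X Y, Mor X Y -> ab_lin;
  kerm : forall X Y (f : Mor X Y), Mor (ker f) X;
  kerm_mono : forall X Y (f : Mor X Y), is_mono (kerm f);
  kerm0 : forall X Y (f : Mor X Y), f ∘ kerm f = 0;
  ker_lift : forall X Y (f : Mor X Y) Z (g : Mor Z X),
    f ∘ g = 0 -> Mor Z (ker f);
  ker_liftE : forall X Y (f : Mor X Y) Z (g : Mor Z X) (fg0 : f ∘ g = 0),
    kerm f ∘ ker_lift fg0 = g;
  coker : forall X Y, Mor X Y -> ab_lin;
  cokerm : forall X Y (f : Mor X Y), Mor Y (coker f);
  cokerm_epi : forall X Y (f : Mor X Y), is_epi (cokerm f);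
  cokerm0 : forall X Y (f : Mor X Y), cokerm f ∘ f = 0;
  coker_desc : forall X Y (f : Mor X Y) Z (g : Mor Y Z),
    g ∘ f = 0 -> Mor (coker f) Z;
  coker_descE : forall X Y (f : Mor X Y) Z (g : Mor Y Z) (gf0 : g ∘ f = 0),
    coker_desc gf0 ∘ cokerm f = g;
  mono_normal : forall X Y (f : Mor X Y), is_mono f ->
    forall Z (g : Mor Z Y), cokerm f ∘ g = 0 -> exists h : Mor Z X, f ∘ h = g;
  epi_normal : forall X Y (f : Mor X Y), is_epi f ->
    forall Z (g : Mor X Z), g ∘ kerm f = 0 -> exists h : Mor Y Z, h ∘ f = g
}.
Arguments zobj {k} a.
Arguments inl_ {k a} X Y.
Arguments inr_ {k a} X Y.
Arguments prl_ {k a} X Y.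
Arguments prr_ {k a} X Y.
Notation "X ⊕ Y" := (bip X Y) : cat_scope.

Section Additivity.
Variables (k : fieldType) (C : linear_category k).

Lemma compDr (A B D : C) (g : Mor B D) (u v : Mor A B) :
  g ∘ (u + v) = g ∘ u + g ∘ v.
Proof. by have := comp_linear_r g 1 u v; rewrite !scale1r. Qed.

Lemma compDl (A B D : C) (g : Mor A B) (u v : Mor B D) :
  (u + v) ∘ g = u ∘ g + v ∘ g.
Proof. by have := comp_linear_l g 1 u v; rewrite !scale1r. Qed.

Lemma compm0 (A B D : C) (g : Mor B D) : g ∘ (0 : Mor A B) = 0.
Proof. by apply: (addrI (g ∘ 0)); rewrite -compDr !addr0. Qed.

Lemma comp0m (A B D : C) (g : Mor A B) : (0 : Mor B D) ∘ g = 0.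
Proof. by apply: (addrI (0 ∘ g)); rewrite -compDl !addr0. Qed.

Lemma compBr (A B D : C) (g : Mor B D) (u v : Mor A B) :
  g ∘ (u - v) = g ∘ u - g ∘ v.
Proof. by apply/eqP; rewrite eq_sym subr_eq -compDr subrK. Qed.

Lemma compBl (A B D : C) (g : Mor A B) (u v : Mor B D) :
  (u - v) ∘ g = u ∘ g - v ∘ g.
Proof. by apply/eqP; rewrite eq_sym subr_eq -compDl subrK. Qed.

End Additivity.

Section Biproducts.
Variables (k : fieldType) (C : abelian_category k).

Lemma prr_inl (X Y : C) : prr_ X Y ∘ inl_ X Y = 0.
Proof.
have := congr1 (fun h => prr_ X Y ∘ (h ∘ inl_ X Y)) (bip_id X Y).
rewrite comp1m compDl compDr -!compA prl_inl compm1 (compA (prr_ _ _)) prr_inr.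
by rewrite comp1m -[RHS]addr0 => /addrI.
Qed.

Lemma prl_inr (X Y : C) : prl_ X Y ∘ inr_ X Y = 0.
Proof.
have := congr1 (fun h => prl_ X Y ∘ (h ∘ inr_ X Y)) (bip_id X Y).
rewrite comp1m compDl compDr -!compA prr_inr compm1 (compA (prl_ _ _)) prl_inl.
by rewrite comp1m -[RHS]add0r => /addIr.
Qed.

End Biproducts.

Section FiniteSums.
Variables (k : fieldType) (C : abelian_category k) (T : Type).

Fixpoint dsum (F : T -> C) (s : seq T) : C :=
  if s is t :: s' then F t ⊕ dsum F s' else zobj C.

Fixpoint dsum_pair (Z : C) (F : T -> C) (f : forall t, Mor Z (F t)) (s : seq T) :
    Mor Z (dsum F s) :=
  if s is t :: s' then inl_ _ _ ∘ f t + inr_ _ _ ∘ dsum_pair f s' else 0.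

Fixpoint dsum_copair (Z : C) (F : T -> C) (f : forall t, Mor (F t) Z) (s : seq T) :
    Mor (dsum F s) Z :=
  if s is t :: s' then f t ∘ prl_ _ _ + dsum_copair f s' ∘ prr_ _ _ else 0.

Lemma comp_dsum_copair (Z W : C) (F : T -> C) (h : Mor Z W)
    (f : forall t, Mor (F t) Z) s :
  h ∘ dsum_copair f s = dsum_copair (fun t => h ∘ f t) s.
Proof. by elim: s => [|t s IHs] /=; rewrite ?compm0 // compDr !compA IHs. Qed.

End FiniteSums.

Lemma dsum_copair_eq0 (k : fieldType) (C : abelian_category k) (T : eqType)
    (Z : C) (F : T -> C) (f : forall t, Mor (F t) Z) (s : seq T) :
  dsum_copair f s = 0 <-> {in s, forall t, f t = 0}.
Proof.
elim: s => [|t s IHs] /=; first by split.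
split=> [H t' | H]; last first.
  rewrite H ?mem_head // comp0m add0r; have/IHs-> : {in s, forall t, f t = 0}.
    by move=> t' t's; apply: H; rewrite inE t's orbT.
  exact: comp0m.
rewrite inE => /orP[/eqP-> | t's].
  have := congr1 (fun h => h ∘ inl_ _ _) H.
  by rewrite comp0m compDl -!compA prl_inl prr_inl compm0 compm1 addr0.
apply: (IHs.1 _ _ t's).
have := congr1 (fun h => h ∘ inr_ _ _) H.
by rewrite comp0m compDl -!compA prl_inr prr_inr compm0 compm1 add0r.
Qed.

(** * The ind-completion *)

(* For small abelian C the ind-completion is the category of k-linear left exact
   functors C^op -> Mod_k (with C embedded by Yoneda).  Left exactness is stated on
   the right exact sequences A -> B -> coker f -> 0. *)
Record ind_object (k : fieldType) (C : abelian_category k) := IndObject {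
  ind_ev :> C -> lmodType k;
  ind_res : forall A B : C, Mor A B -> ind_ev B -> ind_ev A;
  ind_res1 : forall A (x : ind_ev A), ind_res (idm A) x = x;
  ind_resM : forall A B D (g : Mor B D) (f : Mor A B) x,
    ind_res (g ∘ f) x = ind_res f (ind_res g x);
  ind_res_linear : forall A B (f : Mor A B), linear (ind_res f);
  ind_res_linear_hom : forall A B (x : ind_ev B),
    linear (fun f : Mor A B => ind_res f x);
  ind_lex_inj : forall A B (f : Mor A B), injective (ind_res (cokerm f));
  ind_lex_exact : forall A B (f : Mor A B) (x : ind_ev B),
    ind_res f x = 0 -> exists y, ind_res (cokerm f) y = x
}.
Arguments ind_res {k C} i {A B} f x.

Record ind_hom (k : fieldType) (C : abelian_category k) (P Q : ind_object C) :=
  IndHom {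
  ind_app :> forall A, P A -> Q A;
  ind_app_linear : forall A, linear (@ind_app A);
  ind_app_nat : forall A B (f : Mor A B) x,
    ind_app (ind_res P f x) = ind_res Q f (ind_app x)
}.
Arguments ind_app {k C P Q} i {A} x.

Section Ind.
Variables (k : fieldType) (C : abelian_category k).
Implicit Types P Q S : ind_object C.

Definition ind_eq P Q (u v : ind_hom P Q) : Prop :=
  forall A (x : P A), u A x = v A x.

Lemma ind_comp_linear P Q S (v : ind_hom Q S) (u : ind_hom P Q) A :
  linear (fun x : P A => v A (u A x)).
Proof. by move=> a x y; rewrite !ind_app_linear. Qed.

Lemma ind_comp_nat P Q S (v : ind_hom Q S) (u : ind_hom P Q) A B (f : Mor A B) x :
  v A (u A (ind_res P f x)) = ind_res S f (v B (u B x)).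
Proof. by rewrite !ind_app_nat. Qed.

Definition ind_comp P Q S (v : ind_hom Q S) (u : ind_hom P Q) : ind_hom P S :=
  IndHom (ind_comp_linear v u) (ind_comp_nat v u).

Lemma ind_id_linear P A : linear (fun x : P A => x).
Proof. by []. Qed.

Lemma ind_id_nat P A B (f : Mor A B) (x : P B) : ind_res P f x = ind_res P f x.
Proof. by []. Qed.

Definition ind_id P : ind_hom P P :=
  @IndHom _ _ P P (fun A x => x) (@ind_id_linear P) (@ind_id_nat P).

Definition ind_is_mono P Q (u : ind_hom P Q) : Prop :=
  forall S (v w : ind_hom S P),
    ind_eq (ind_comp u v) (ind_comp u w) -> ind_eq v w.

Definition ind_is_epi P Q (u : ind_hom P Q) : Prop :=
  forall S (v w : ind_hom Q S),
    ind_eq (ind_comp v u) (ind_comp w u) -> ind_eq v w.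

Definition ind_isomorphic P Q : Prop :=
  exists (u : ind_hom P Q) (v : ind_hom Q P),
    ind_eq (ind_comp v u) (ind_id P) /\ ind_eq (ind_comp u v) (ind_id Q).

Definition is_ind_coproduct (F : nat -> ind_object C) S
    (inj : forall n, ind_hom (F n) S) : Prop :=
  forall Q (u : forall n, ind_hom (F n) Q),
    exists w : ind_hom S Q,
      (forall n, ind_eq (ind_comp w (inj n)) (u n)) /\
      forall w' : ind_hom S Q,
        (forall n, ind_eq (ind_comp w' (inj n)) (u n)) -> ind_eq w' w.

(* [m ∘ e] is the epi-mono factorization of [u], i.e. [I] is the image of [u]. *)
Definition is_ind_image P Q (u : ind_hom P Q) I
    (e : ind_hom P I) (m : ind_hom I Q) : Prop :=
  [/\ ind_is_epi e, ind_is_mono m & ind_eq (ind_comp m e) u].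

Section Yoneda.
Variable Y : C.

Lemma yo_res1 A (x : Mor A Y) : x ∘ idm A = x.
Proof. exact: compm1. Qed.

Lemma yo_resM A B D (g : Mor B D) (f : Mor A B) (x : Mor D Y) :
  x ∘ (g ∘ f) = (x ∘ g) ∘ f.
Proof. exact: compA. Qed.

Lemma yo_res_linear A B (f : Mor A B) : linear (fun x : Mor B Y => x ∘ f).
Proof. exact: comp_linear_l. Qed.

Lemma yo_res_linear_hom A B (x : Mor B Y) : linear (fun f : Mor A B => x ∘ f).
Proof. exact: comp_linear_r. Qed.

Lemma yo_lex_inj A B (f : Mor A B) :
  injective (fun x : Mor (coker f) Y => x ∘ cokerm f).
Proof. by move=> x y; apply: cokerm_epi. Qed.

Lemma yo_lex_exact A B (f : Mor A B) (x : Mor B Y) :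
  x ∘ f = 0 -> exists y : Mor (coker f) Y, y ∘ cokerm f = x.
Proof. by move=> xf0; exists (coker_desc xf0); apply: coker_descE. Qed.

Definition yo : ind_object C :=
  @IndObject _ C (fun A => Mor A Y) (fun A B f x => x ∘ f)
    yo_res1 yo_resM yo_res_linear yo_res_linear_hom yo_lex_inj yo_lex_exact.

End Yoneda.

Section YonedaMap.
Variables (X Y : C) (f : Mor X Y).

Lemma yo_map_linear A : linear (fun x : Mor A X => f ∘ x).
Proof. exact: comp_linear_r. Qed.

Lemma yo_map_nat A B (g : Mor A B) (x : Mor B X) : f ∘ (x ∘ g) = (f ∘ x) ∘ g.
Proof. exact: compA. Qed.

Definition yo_map : ind_hom (yo X) (yo Y) :=
  @IndHom _ _ (yo X) (yo Y) (fun A x => f ∘ x) yo_map_linear yo_map_nat.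

End YonedaMap.

(* The object belongs to C, seen inside its ind-completion. *)
Definition ind_finite P : Prop := exists Y : C, ind_isomorphic P (yo Y).

End Ind.

(** * Tensor categories *)

Record tensor_category (k : fieldType) := TensorCategory {
  tc_ab :> abelian_category k;
  tunit : tc_ab;
  tens : tc_ab -> tc_ab -> tc_ab;
  tensm : forall X X' Y Y' : tc_ab,
    Mor X X' -> Mor Y Y' -> Mor (tens X Y) (tens X' Y');
  tensm1 : forall X Y, tensm (idm X) (idm Y) = idm (tens X Y);
  tensmM : forall X X' X'' Y Y' Y'' (f' : Mor X' X'') (f : Mor X X')
      (g' : Mor Y' Y'') (g : Mor Y Y'),
    tensm (f' ∘ f) (g' ∘ g) = tensm f' g' ∘ tensm f g;
  tensm_linear_l : forall X X' Y Y' (g : Mor Y Y'),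
    linear (fun f : Mor X X' => tensm f g);
  tensm_linear_r : forall X X' Y Y' (f : Mor X X'),
    linear (fun g : Mor Y Y' => tensm f g);
  assoc : forall X Y Z, Mor (tens (tens X Y) Z) (tens X (tens Y Z));
  assocV : forall X Y Z, Mor (tens X (tens Y Z)) (tens (tens X Y) Z);
  assocK : forall X Y Z, assocV X Y Z ∘ assoc X Y Z = idm _;
  assocVK : forall X Y Z, assoc X Y Z ∘ assocV X Y Z = idm _;
  assoc_nat : forall X X' Y Y' Z Z' (f : Mor X X') (g : Mor Y Y') (h : Mor Z Z'),
    assoc X' Y' Z' ∘ tensm (tensm f g) h = tensm f (tensm g h) ∘ assoc X Y Z;
  lunit : forall X, Mor (tens tunit X) X;
  lunit_iso : forall X, is_iso (lunit X);
  lunit_nat : forall X Y (f : Mor X Y), lunit Y ∘ tensm (idm tunit) f = f ∘ lunit X;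
  runit : forall X, Mor (tens X tunit) X;
  runit_iso : forall X, is_iso (runit X);
  runit_nat : forall X Y (f : Mor X Y), runit Y ∘ tensm f (idm tunit) = f ∘ runit X;
  braid : forall X Y, Mor (tens X Y) (tens Y X);
  braid_nat : forall X X' Y Y' (f : Mor X X') (g : Mor Y Y'),
    braid X' Y' ∘ tensm f g = tensm g f ∘ braid X Y;
  braid_sym : forall X Y, braid Y X ∘ braid X Y = idm (tens X Y);
  pentagon : forall W X Y Z,
    assoc W X (tens Y Z) ∘ assoc (tens W X) Y Z =
    tensm (idm W) (assoc X Y Z) ∘ assoc W (tens X Y) Z ∘ tensm (assoc W X Y) (idm Z);
  triangle : forall X Y,
    tensm (idm X) (lunit Y) ∘ assoc X tunit Y = tensm (runit X) (idm Y);
  hexagon : forall X Y Z,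
    assoc Y Z X ∘ braid X (tens Y Z) ∘ assoc X Y Z =
    tensm (idm Y) (braid X Z) ∘ assoc Y X Z ∘ tensm (braid X Y) (idm Z);
  rigid : forall X, exists (D : tc_ab) (ev : Mor (tens D X) tunit)
      (coev : Mor tunit (tens X D)),
    runit X ∘ tensm (idm X) ev ∘ assoc X D X ∘ tensm coev (idm X) = lunit X /\
    lunit D ∘ tensm ev (idm D) ∘ assocV D X D ∘ tensm (idm D) coev = runit D;
  unit_scalars : bijective (fun a : k => a *: idm tunit)
}.
Arguments tunit {k} t.
Arguments assoc {k t} X Y Z.
Arguments assocV {k t} X Y Z.
Arguments lunit {k t} X.
Arguments runit {k t} X.
Arguments braid {k t} X Y.
Notation "X ⊗ Y" := (tens X Y) : cat_scope.
Notation "f ⊠ g" := (tensm f g) : cat_scope.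

Record pretannakian_category (k : fieldType) := PretannakianCategory {
  pt_tens :> tensor_category k;
  finite_length : forall X : pt_tens, exists n, has_length X n
}.

(* Independent of the choice by the Jordan-Holder theorem. *)
Definition len (k : fieldType) (C : pretannakian_category k) (X : C) : nat :=
  sval (cid (finite_length X)).

Record tensor_functor (k : fieldType) (C D : tensor_category k) := TensorFunctor {
  fobj :> C -> D;
  fmap : forall X Y : C, Mor X Y -> Mor (fobj X) (fobj Y);
  fmap1 : forall X, fmap (idm X) = idm (fobj X);
  fmapM : forall X Y Z (g : Mor Y Z) (f : Mor X Y), fmap (g ∘ f) = fmap g ∘ fmap f;
  fmap_linear : forall X Y, linear (@fmap X Y);
  fmap_exact : forall X Y Z (i : Mor X Y) (p : Mor Y Z),
    short_exact i p -> short_exact (fmap i) (fmap p);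
  fmul : forall X Y, Mor (fobj X ⊗ fobj Y) (fobj (X ⊗ Y));
  fmul_iso : forall X Y, is_iso (fmul X Y);
  fmul_nat : forall X X' Y Y' (f : Mor X X') (g : Mor Y Y'),
    fmul X' Y' ∘ (fmap f ⊠ fmap g) = fmap (f ⊠ g) ∘ fmul X Y;
  funit : Mor (tunit D) (fobj (tunit C));
  funitV : Mor (fobj (tunit C)) (tunit D);
  funitK : funitV ∘ funit = idm _;
  funitVK : funit ∘ funitV = idm _;
  fmul_assoc : forall X Y Z,
    fmap (assoc X Y Z) ∘ fmul (X ⊗ Y) Z ∘ (fmul X Y ⊠ idm (fobj Z)) =
    fmul X (Y ⊗ Z) ∘ (idm (fobj X) ⊠ fmul Y Z) ∘ assoc (fobj X) (fobj Y) (fobj Z);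
  fmul_lunit : forall X,
    fmap (lunit X) ∘ fmul (tunit C) X ∘ (funit ⊠ idm (fobj X)) = lunit (fobj X);
  fmul_runit : forall X,
    fmap (runit X) ∘ fmul X (tunit C) ∘ (idm (fobj X) ⊠ funit) = runit (fobj X);
  fmul_braid : forall X Y,
    fmap (braid X Y) ∘ fmul X Y = fmul Y X ∘ braid (fobj X) (fobj Y)
}.

(* The map Hom(X,1) -> Hom(FX,F1) ~ Hom(FX,1) induced by F. *)
Definition hom_unit_map (k : fieldType) (C D : tensor_category k)
    (F : tensor_functor C D) (X : C) (f : Mor X (tunit C)) : Mor (F X) (tunit D) :=
  funitV F ∘ fmap F f.

(** * Symmetric powers *)

Section SymmetricPowers.
Variables (k : fieldType) (C : tensor_category k).

Fixpoint tpow (X : C) (n : nat) : C :=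
  if n is n'.+1 then X ⊗ tpow X n' else tunit C.

Fixpoint tpowm (X Y : C) (f : Mor X Y) (n : nat) : Mor (tpow X n) (tpow Y n) :=
  if n is n'.+1 then f ⊠ tpowm f n' else idm (tunit C).

Definition tswap (X Y : C) : Mor (X ⊗ (X ⊗ Y)) (X ⊗ (X ⊗ Y)) :=
  assoc X X Y ∘ (braid X X ⊠ idm Y) ∘ assocV X X Y.

(* Moves the leading factor to position [i], shifting the factors in between. *)
Fixpoint tmove (X : C) (n i : nat) : Mor (X ⊗ tpow X n) (X ⊗ tpow X n) :=
  match n, i with
  | n'.+1, i'.+1 => (idm X ⊠ tmove X n' i') ∘ tswap X (tpow X n')
  | _, _ => idm _
  end.

(* The permutation action of [s] on the n-th tensor power, sending the factor in
   position [j] to position [s j]: first permute the tail by the permutation that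
   [s] induces on it, then move the head to position [s 0].  It is meaningful for
   bijective [s] only, in which case the default value of [odflt] is not used. *)
Fixpoint tperm_act (X : C) (n : nat) : ('I_n -> 'I_n) -> Mor (tpow X n) (tpow X n) :=
  match n with
  | 0 => fun=> idm _
  | n'.+1 => fun s => tmove X n' (s ord0) ∘
      (idm X ⊠ tperm_act X
         (fun j => odflt j (unlift (s ord0) (s (lift ord0 j)))))
  end.

(* Sym^n is the coinvariants: the quotient of the n-th tensor power by the sum of the
   images of all s - 1, for s a permutation of the n factors. *)
Definition sym_rel (X : C) (n : nat) :
    Mor (dsum (fun=> tpow X n) (enum 'S_n)) (tpow X n) :=
  dsum_copair (fun s : 'S_n => tperm_act X s - idm _) (enum 'S_n).

Definition Sym (X : C) (n : nat) : C := coker (sym_rel X n).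

Definition Sym_le (X : C) (n : nat) : C := dsum (Sym X) (iota 0 n.+1).

Section Functoriality.
Variables (X Y : C) (f : Mor X Y).

Lemma tswap_nat A B (g : Mor A B) :
  tswap Y B ∘ (f ⊠ (f ⊠ g)) = (f ⊠ (f ⊠ g)) ∘ tswap X A.
Proof.
have aV : assocV Y Y B ∘ (f ⊠ (f ⊠ g)) = ((f ⊠ f) ⊠ g) ∘ assocV X X A.
  rewrite -[LHS]compm1 -(assocVK X X A) compA -(compA _ (f ⊠ _)) -assoc_nat.
  by rewrite !compA assocK comp1m.
have b : (braid Y Y ⊠ idm B) ∘ ((f ⊠ f) ⊠ g) = ((f ⊠ f) ⊠ g) ∘ (braid X X ⊠ idm A).
  by rewrite -!tensmM braid_nat comp1m compm1.
by rewrite /tswap -compA aV compA -(compA (assoc _ _ _)) b compA assoc_nat !compA.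
Qed.

Lemma tmove_nat n i :
  tmove Y n i ∘ (f ⊠ tpowm f n) = (f ⊠ tpowm f n) ∘ tmove X n i.
Proof.
elim: n i => [|n IHn] [|i] /=; rewrite ?comp1m ?compm1 //.
rewrite -compA tswap_nat !compA; congr (_ ∘ _).
by rewrite -!tensmM IHn comp1m compm1.
Qed.

Lemma tperm_act_nat n (s : 'I_n -> 'I_n) :
  tperm_act Y s ∘ tpowm f n = tpowm f n ∘ tperm_act X s.
Proof.
elim: n s => [|n IHn] s /=; first by [].
by rewrite -compA -tensmM IHn comp1m compA -tmove_nat -compA -tensmM compm1.
Qed.

Lemma Symm_subproof n : cokerm (sym_rel Y n) ∘ tpowm f n ∘ sym_rel X n = 0.
Proof.
have relY : {in enum 'S_n, forall s : 'S_n,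
    cokerm (sym_rel Y n) ∘ (tperm_act Y s - idm _) = 0}.
  by apply/dsum_copair_eq0; rewrite -comp_dsum_copair cokerm0.
rewrite comp_dsum_copair; apply/dsum_copair_eq0 => s s_enum.
rewrite compBr compm1 -compA -tperm_act_nat compA -[X in _ - X]compm1.
have := relY s s_enum; rewrite compBr compm1 => /eqP; rewrite subr_eq0 => /eqP ->.
by rewrite compm1 subrr.
Qed.

Definition Symm n : Mor (Sym X n) (Sym Y n) := coker_desc (Symm_subproof n).

End Functoriality.

End SymmetricPowers.

Definition sgd (R : realType) (k : fieldType) (C : pretannakian_category k) (X : C) :
    \bar R :=
  limn_esup (fun n => (ln (len (Sym_le X n))%:R / ln n%:R)%:E).

(** * The trivial quotient and the image of Sym(X~) in Sym(X) *)

Section Tilde.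
Variables (k : fieldType) (C : tensor_category k) (X : C).

(* The canonical map X -> Hom(X,1)^* ⊗ 1.  A basis [e] of Hom(X,1) identifies
   Hom(X,1)^* ⊗ 1 with 1^n through the dual basis, and the components of the
   canonical map are then the [e i]. *)
Definition triv_quot n (e : 'I_n -> Mor X (tunit C)) :
    Mor X (dsum (fun=> tunit C) (enum 'I_n)) :=
  dsum_pair e (enum 'I_n).

Definition tilde n (e : 'I_n -> Mor X (tunit C)) : C := ker (triv_quot e).

Definition tilde_incl n (e : 'I_n -> Mor X (tunit C)) : Mor (tilde e) X :=
  kerm (triv_quot e).

(* [S], with [inj], is the direct sum of the Sym^n Y in the ind-completion, i.e. the
   object underlying the symmetric algebra of [Y]. *)
Definition is_sym_alg (Y : C) (S : ind_object C)
    (inj : forall n, ind_hom (yo (Sym Y n)) S) : Prop :=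
  is_ind_coproduct inj.

(* The image of Sym(j) : Sym(Y) -> Sym(X), formed in the ind-completion, is finite.
   Direct sums and images being unique up to isomorphism, it does not matter which
   ones are used. *)
Definition sym_image_finite (Y : C) (j : Mor Y X) : Prop :=
  exists (S' S : ind_object C)
      (inj' : forall n, ind_hom (yo (Sym Y n)) S')
      (inj : forall n, ind_hom (yo (Sym X n)) S)
      (u : ind_hom S' S) (I : ind_object C)
      (e : ind_hom S' I) (m : ind_hom I S),
    [/\ is_sym_alg inj', is_sym_alg inj,
        forall n, ind_eq (ind_comp u (inj' n)) (ind_comp (inj n) (yo_map (Symm j n))),
        is_ind_image u e m & ind_finite I].

Definition tilde_image_finite : Prop :=
  exists n (e : 'I_n -> Mor X (tunit C)),
    is_basis e /\ sym_image_finite (tilde_incl e).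

End Tilde.

(* Main.v *)
(* The maps X -> 1 are killed one at a time: if f : X -> 1 does not vanish on Z in X and W
   is the kernel of f on Z, put I_n(Z) for the image of Sym^n Z -> Sym^n X.  The images J_m
   of W^m Z^(n-m) in Sym^n X form a descending chain from I_n(Z) to I_n(W).  The
   contraction by f^(n-m), taken with divided powers, maps J_m onto I_m(W) and kills
   J_(m+1); conversely J_m / J_(m+1) is a quotient of I_m(W), since (Z/W)^(n-m) = 1.  Hence
   l(I_n(Z)) is the sum of the l(I_m(W)) over m <= n.  Iterating down to the common kernel
   X~ of the d = dim Hom(X, 1) maps, l(Sym^(<= n) X) is the (d+1)-fold iterated partial sum
   of l(I_n(X~)).  It grows like n^d if I_n(X~) = 0 for large n, and at least like n^(d+1)
   otherwise, because I_n(X~) = 0 implies I_(n+1)(X~) = 0.  Finally, if g : FX -> 1 is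
   nonzero on F(X~), then g^n : F(X^n) -> 1 factors through F(Sym^n X) and is nonzero on
   F(X~^n), so that no I_n(X~) vanishes. *)

Require Import Defs.
From HB Require Import structures.
From mathcomp Require Import all_boot all_order all_algebra.
From mathcomp Require Import perm boolp classical_sets functions.
From mathcomp Require Import reals constructive_ereal ereal.
From mathcomp Require Import exp sequences normedtype.
(* [compA] must denote the law of categories rather than that of functions. *)
Import Defs.

Set Implicit Arguments.
Unset Strict Implicit.
Unset Printing Implicit Defensive.

Import Order.TTheory GRing.Theory Num.Theory.
Local Open Scope ring_scope.
Local Open Scope cat_scope.

(** * Abelian categories and length *)

(** The delicate half of the length count is the lower bound for $\ell(J_m/J_{m+1})$: it needs a map
    out of $\mathrm{Sym}^nX$ that kills $J_{m+1}$ but not $J_m$. The $(n-m)$-fold iterate of the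
    derivation given by $f$ acts on $W^mZ^{n-m}$ as $(n-m)!$ times the wanted map, hence by zero in
    small positive characteristic. The divided power is therefore written down on $X^{\otimes n}$ as
    a sum over subsets of factors, without denominators, and then shown to descend to coinvariants.
    The upper bound uses only multiplication in the symmetric algebra and right exactness of
    $\otimes$, which comes from duals. That a nonzero map to $\mathbf{1}$ is onto, so that
    $Z/W=\mathbf{1}$, is not an axiom: it rests on simplicity of the unit, proved from rigidity and
    $\mathrm{End}(\mathbf{1})=\mathbf{k}$. Images are never compared as subobjects. They enter as
    ranks (lengths of images) of maps out of tensor powers, so that sources can be changed along
    epimorphisms. Coinvariants are tested on adjacent swaps alone, which avoids proving that
    [tperm_act] is a group action. *)

Section Linear.
Variables (k : fieldType) (C : linear_category k).
Implicit Types A B D P S T U W X Y Z : C.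

Lemma compZr X Y Z (g : Mor Y Z) a (f : Mor X Y) : g ∘ (a *: f) = a *: (g ∘ f).
Proof. by have := comp_linear_r g a f 0; rewrite compm0 !addr0. Qed.

Lemma compZl X Y Z (f : Mor X Y) a (g : Mor Y Z) : (a *: g) ∘ f = a *: (g ∘ f).
Proof. by have := comp_linear_l f a g 0; rewrite comp0m !addr0. Qed.

Lemma comp_sumr X Y Z (g : Mor Y Z) n (f : 'I_n -> Mor X Y) :
  g ∘ (\sum_i f i) = \sum_i g ∘ f i.
Proof. by elim/big_rec2: _ => [|i u v _ <-]; rewrite ?compm0 ?compDr. Qed.

Lemma comp_suml X Y Z (f : Mor X Y) n (g : 'I_n -> Mor Y Z) :
  (\sum_i g i) ∘ f = \sum_i g i ∘ f.
Proof. by elim/big_rec2: _ => [|i u v _ <-]; rewrite ?comp0m ?compDl. Qed.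

Lemma compAE X Y Z (g : Mor Y Z) (f : Mor X Y) x :
  g ∘ f = x -> forall T (h : Mor T X), g ∘ (f ∘ h) = x ∘ h.
Proof. by move=> <- T h; rewrite compA. Qed.

Lemma mono_cancel0 X Y (f : Mor X Y) :
  is_mono f <-> forall Z (u : Mor Z X), f ∘ u = 0 -> u = 0.
Proof.
split=> [fm Z u fu | H Z u v fuv]; first by apply: fm; rewrite compm0.
by apply/eqP; rewrite -subr_eq0; apply/eqP/H; rewrite compBr fuv subrr.
Qed.

Lemma epi_cancel0 X Y (f : Mor X Y) :
  is_epi f <-> forall Z (u : Mor Y Z), u ∘ f = 0 -> u = 0.
Proof.
split=> [fe Z u fu | H Z u v fuv]; first by apply: fe; rewrite comp0m.
by apply/eqP; rewrite -subr_eq0; apply/eqP/H; rewrite compBl fuv subrr.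
Qed.

Lemma mono_eq0 X Y Z (f : Mor X Y) (u : Mor Z X) : is_mono f -> f ∘ u = 0 -> u = 0.
Proof. by move/mono_cancel0; apply. Qed.

Lemma epi_eq0 X Y Z (f : Mor X Y) (u : Mor Y Z) : is_epi f -> u ∘ f = 0 -> u = 0.
Proof. by move/epi_cancel0; apply. Qed.

Lemma mono_comp X Y Z (g : Mor Y Z) (f : Mor X Y) :
  is_mono g -> is_mono f -> is_mono (g ∘ f).
Proof. by move=> gm fm T u v; rewrite -!compA => /gm /fm. Qed.

Lemma epi_comp X Y Z (g : Mor Y Z) (f : Mor X Y) :
  is_epi g -> is_epi f -> is_epi (g ∘ f).
Proof. by move=> ge fe T u v; rewrite !compA => /fe /ge. Qed.

Lemma mono_compr X Y Z (g : Mor Y Z) (f : Mor X Y) : is_mono (g ∘ f) -> is_mono f.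
Proof. by move=> gm T u v fuv; apply: gm; rewrite -!compA fuv. Qed.

Lemma epi_compl X Y Z (g : Mor Y Z) (f : Mor X Y) : is_epi (g ∘ f) -> is_epi g.
Proof. by move=> gm T u v fuv; apply: gm; rewrite !compA fuv. Qed.

Lemma iso_mono X Y (f : Mor X Y) : is_iso f -> is_mono f.
Proof.
by case=> g [gf _] Z u v fuv; rewrite -[u]comp1m -[v]comp1m -gf -!compA fuv.
Qed.

Lemma iso_epi X Y (f : Mor X Y) : is_iso f -> is_epi f.
Proof.
by case=> g [_ fg] Z u v fuv; rewrite -[u]compm1 -[v]compm1 -fg !compA fuv.
Qed.

Lemma iso_id X : is_iso (idm X).
Proof. by exists (idm X); rewrite comp1m. Qed.

Lemma iso_comp X Y Z (g : Mor Y Z) (f : Mor X Y) :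
  is_iso g -> is_iso f -> is_iso (g ∘ f).
Proof.
case=> g' [gK Kg] [f' [fK Kf]]; exists (f' ∘ g').
by split; rewrite compA; [rewrite -(compA f') gK | rewrite -(compA g) Kf];
  rewrite compm1.
Qed.

Lemma zero_mor_to X Y (f : Mor X Y) : is_zero Y -> f = 0.
Proof. by move=> Y0; rewrite -[f]comp1m Y0 comp0m. Qed.

Lemma zero_mor_from X Y (f : Mor X Y) : is_zero X -> f = 0.
Proof. by move=> X0; rewrite -[f]compm1 X0 compm0. Qed.

Lemma mono_zero X Y (f : Mor X Y) : is_mono f -> is_zero Y -> is_zero X.
Proof.
by move=> fm Y0; apply: fm; rewrite [LHS](zero_mor_to _ Y0) [RHS](zero_mor_to _ Y0).
Qed.

Lemma epi_zero X Y (f : Mor X Y) : is_epi f -> is_zero X -> is_zero Y.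
Proof.
by move=> fe X0; apply: fe; rewrite [LHS](zero_mor_from _ X0) [RHS](zero_mor_from _ X0).
Qed.

Lemma mono0_zero X Y : is_mono (0 : Mor X Y) -> is_zero X.
Proof. by move/mono_cancel0; apply; rewrite comp0m. Qed.

Lemma epi0_zero X Y : is_epi (0 : Mor X Y) -> is_zero Y.
Proof. by move/epi_cancel0; apply; rewrite compm0. Qed.

Lemma has_length_zero X n : is_zero X -> has_length X n -> n = 0%N.
Proof.
move=> X0 H; case: H X0 => // {X n} X Y Z n i p [_ pe _ _] [Z0 _] _ Y0.
by case: Z0; apply: epi_zero pe Y0.
Qed.

Lemma has_length0_zero X : has_length X 0 -> is_zero X.
Proof.
move=> H; have : 0%N = 0%N by []; move: {1 3}0%N H => n H n0.
by case: H n0.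
Qed.

Lemma has_lengthS_inv Y n : has_length Y n.+1 ->
  exists X Z (i : Mor X Y) (p : Mor Y Z),
    [/\ short_exact i p, is_simple Z & has_length X n].
Proof.
move E: n.+1 => m H; case: H E => // {m}X {}Y Z m i p ip Zs Xm [->].
by exists X, Z, i, p.
Qed.

End Linear.

Section Abelian.
Variables (k : fieldType) (C : abelian_category k).
Implicit Types A B D P S T U W X Y Z : C.

Lemma mono_epi_iso X Y (f : Mor X Y) : is_mono f -> is_epi f -> is_iso f.
Proof.
move=> fm fe; have [|g fg] := mono_normal fm (g := idm Y).
  by rewrite (epi_eq0 fe (cokerm0 f)) comp0m.
by exists g; split=> //; apply: fm; rewrite compA fg comp1m compm1.
Qed.

Lemma ker_ses X Y (f : Mor X Y) : is_epi f -> short_exact (kerm f) f.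
Proof.
move=> fe; split=> //; [exact: kerm_mono | exact: kerm0 |].
by move=> W g fg; exists (ker_lift fg); apply: ker_liftE.
Qed.

Lemma coker_ses X Y (f : Mor X Y) : is_mono f -> short_exact f (cokerm f).
Proof.
move=> fm; split=> //; [exact: cokerm_epi | exact: cokerm0 |].
by move=> W g; apply: mono_normal.
Qed.

Lemma ses_desc X Y Z (i : Mor X Y) (p : Mor Y Z) : short_exact i p ->
  forall W (g : Mor Y W), g ∘ i = 0 -> exists h, h ∘ p = g.
Proof.
case=> _ pe pi0 lift W g gi; apply: (epi_normal pe).
by have [h <-] := lift _ _ (kerm0 p); rewrite compA gi comp0m.
Qed.

(* The coimage of [f]; the second factor of [f = im_incl f ∘ im_proj f] is
   mono, so this is also its image. *)
Definition im X Y (f : Mor X Y) : C := coker (kerm f).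
Definition im_proj X Y (f : Mor X Y) : Mor X (im f) := cokerm (kerm f).
Definition im_incl X Y (f : Mor X Y) : Mor (im f) Y := coker_desc (kerm0 f).

Lemma im_projE X Y (f : Mor X Y) : im_incl f ∘ im_proj f = f.
Proof. exact: coker_descE. Qed.

Lemma im_proj_epi X Y (f : Mor X Y) : is_epi (im_proj f).
Proof. exact: cokerm_epi. Qed.

Arguments im_proj_epi {X Y} f.

(** If [im_incl f] kills [t], it factors through the cokernel [q] of [t]. Then [f] kills the kernel
    of [q ∘ im_proj f], so does [im_proj f], and normality of epis makes [q] split mono, whence
    [t = 0]. *)
Lemma im_incl_mono X Y (f : Mor X Y) : is_mono (im_incl f).
Proof.
apply/mono_cancel0 => T t ct0; set q := cokerm t.
pose c' := coker_desc ct0; have c'q : c' ∘ q = im_incl f := coker_descE ct0.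
have qpe : is_epi (q ∘ im_proj f).
  exact: epi_comp (cokerm_epi (f := t)) (im_proj_epi f).
have [|h hqp] := epi_normal qpe (g := im_proj f).
  have fk : f ∘ kerm (q ∘ im_proj f) = 0.
    have: im_incl f ∘ im_proj f ∘ kerm (q ∘ im_proj f) = 0.
      by rewrite -c'q -compA -compA (compA q) kerm0 compm0.
    by rewrite im_projE.
  by rewrite -(ker_liftE fk) compA cokerm0 comp0m.
have hq : h ∘ q = idm _.
  by apply: (im_proj_epi f); rewrite -compA hqp comp1m.
by rewrite -[t]comp1m -hq -compA cokerm0 compm0.
Qed.

Arguments im_incl_mono {X Y} f.

Lemma im_fact X Y (f : Mor X Y) :
  exists I (e : Mor X I) (m : Mor I Y), [/\ is_epi e, is_mono m & m ∘ e = f].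
Proof.
exists (im f), (im_proj f), (im_incl f); split; last exact: im_projE.
  exact: im_proj_epi.
exact: im_incl_mono.
Qed.

(** The pullback is the kernel of [s = f ∘ prl - g ∘ prr]. A map [u] killing the projection to [B]
    makes [u ∘ prr] factor through the epi [s]; restricting to the summand [A] shows that the factor
    is zero. *)
Lemma epi_pullback A B D (f : Mor A D) (g : Mor B D) : is_epi f ->
  exists P (p : Mor P A) (q : Mor P B), is_epi q /\ f ∘ p = g ∘ q.
Proof.
move=> fe; set s := f ∘ prl_ A B - g ∘ prr_ A B.
have se : is_epi s.
  apply: (@epi_compl _ _ _ _ _ _ (inl_ A B)).
  by rewrite /s compBl -!compA prl_inl prr_inl compm1 compm0 subr0.
exists (ker s), (prl_ A B ∘ kerm s), (prr_ A B ∘ kerm s); split; last first.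
  by apply/eqP; rewrite -subr_eq0 !compA -compBl kerm0.
apply/epi_cancel0 => U u us.
have [|v vs] := epi_normal se (g := u ∘ prr_ A B); first by rewrite -compA.
have v0 : v = 0.
  apply: (epi_eq0 fe).
  have := congr1 (fun h => h ∘ inl_ A B) vs.
  rewrite -!compA prr_inl compm0 /s compBl -!compA prl_inl prr_inl compm0.
  by rewrite subr0 compm1.
have := congr1 (fun h => h ∘ inr_ A B) vs.
by rewrite v0 !comp0m -compA prr_inr compm1.
Qed.

(** Replaces the choice of a preimage of an element: a map into the target of an epi lifts after
    passing to an epi cover of its source. The next lemma removes the cover again. *)
Lemma epi_lift A D (f : Mor A D) T (g : Mor T D) : is_epi f ->
  exists P (e : Mor P T) (p : Mor P A), is_epi e /\ f ∘ p = g ∘ e.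
Proof. by move=> fe; have [P [p [q [qe pq]]]] := epi_pullback g fe; exists P, q, p. Qed.

Lemma mono_lift_epi A D (m : Mor A D) T P (g : Mor T D) (e : Mor P T) (y : Mor P A) :
  is_mono m -> is_epi e -> m ∘ y = g ∘ e -> exists h, m ∘ h = g.
Proof.
move=> mm ee my; apply: (mono_normal mm).
by apply: (epi_eq0 ee); rewrite -compA -my compA cokerm0 comp0m.
Qed.

Lemma nonzero_to_simple X S (f : Mor X S) : is_simple S -> f <> 0 -> is_epi f.
Proof.
move=> [S0 Ss] f0; have [I [e [m [ee mm E]]]] := im_fact f.
case: (Ss _ _ mm) => [I0 | mi].
  by case: f0; rewrite -E (zero_mor_to e I0) compm0.
by rewrite -E; apply: epi_comp ee; apply: iso_epi.
Qed.

(** Induction on a series of the middle object with top factor [S]. Either [X] maps to zero in [S],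
    and [S] is a top factor of [Z]; or [X] maps onto the simple [S], and [S] is a top factor of [X].
    Removing it leaves a shorter exact sequence. *)
Lemma has_length_ses n X Y Z (i : Mor X Y) (p : Mor Y Z) :
  short_exact i p -> has_length Y n ->
  exists a c, [/\ (a + c)%N = n, has_length X a & has_length Z c].
Proof.
elim: n X Y Z i p => [|n IHn] A B D i p [im pe pi lift].
  move/has_length0_zero => B0; exists 0%N, 0%N; split=> //; constructor.
    exact: mono_zero im B0.
  exact: epi_zero pe B0.
case/has_lengthS_inv => B' [S [j [s [[jm se sj slift] Ss B'n]]]].
have [si0 | si0] := pselect (s ∘ i = 0).
  have [i' ji'] := slift _ _ si0.
  have i'm : is_mono i' by apply: (@mono_compr _ _ _ _ _ j); rewrite ji'.
  have [a [c [acn Aa D'c]]] := IHn _ _ _ _ _ (coker_ses i'm) B'n.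
  exists a, c.+1; split; rewrite ?addnS ?acn //.
  have pji : (p ∘ j) ∘ i' = 0 by rewrite -compA ji'.
  have [t tp] := ses_desc (And4 im pe pi lift) si0.
  pose d := coker_desc pji; have dp : d ∘ cokerm i' = p ∘ j := coker_descE pji.
  have dm : is_mono d.
    apply/mono_cancel0 => T x dx0.
    have [P [e [y [ee ye]]]] := epi_lift x (cokerm_epi (f := i')).
    have [|a' ia'] := lift _ (j ∘ y).
      by rewrite compA -dp -compA ye compA dx0 comp0m.
    have ya' : y = i' ∘ a' by apply: jm; rewrite compA ji' ia'.
    apply: (epi_eq0 ee).
    by rewrite -ye ya' compA cokerm0 comp0m.
  apply: has_lengthS Ss D'c; split.
  - exact: dm.
  - by apply: (@epi_compl _ _ _ _ _ t p); rewrite tp.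
  - apply: (epi_eq0 (cokerm_epi (f := i'))).
    by rewrite -compA dp compA tp sj.
  - move=> T g tg0; have [P [e [y [ee ye]]]] := epi_lift g pe.
    have [|b jb] := slift _ y; first by rewrite -tp -compA ye compA tg0 comp0m.
    apply: (mono_lift_epi dm ee (y := cokerm i' ∘ b)).
    by rewrite compA dp -compA jb ye.
have sie := nonzero_to_simple Ss si0.
have ksi : s ∘ (i ∘ kerm (s ∘ i)) = 0 by rewrite compA kerm0.
have [i' ji'] := slift _ _ ksi.
have ses' : short_exact i' (p ∘ j).
  split.
  - by apply: (@mono_compr _ _ _ _ _ j); rewrite ji'; apply/mono_comp/kerm_mono.
  - apply/epi_cancel0 => U u upj.
    have [|v vs] := ses_desc (And4 jm se sj slift) (g := u ∘ p); first by rewrite -compA.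
    have v0 : v = 0.
      apply: (epi_eq0 sie).
      by rewrite compA vs -compA pi compm0.
    by apply: (epi_eq0 pe); rewrite -vs v0 comp0m.
  - by rewrite -compA ji' compA pi comp0m.
  - move=> T g pjg; have [|a ia] := lift _ (j ∘ g); first by rewrite compA.
    have sia : (s ∘ i) ∘ a = 0 by rewrite -compA ia compA sj comp0m.
    exists (ker_lift sia); apply: jm.
    by rewrite compA ji' -compA ker_liftE.
have [a [c [acn Aa Dc]]] := IHn _ _ _ _ _ ses' B'n.
exists a.+1, c; split=> //; first by rewrite addSn acn.
exact: has_lengthS (ker_ses sie) Ss Aa.
Qed.

Lemma has_length_simple S n : is_simple S -> has_length S n -> n = 1%N.
Proof.
move=> [S0 Ss]; case: n => [/has_length0_zero //|n].
case/has_lengthS_inv => X [Z [i [p [[im pe pi _] Zs Xn]]]].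
case: (Ss _ _ im) => [X0 | ii].
  by rewrite (has_length_zero X0 Xn).
by case: Zs.1; apply: (@epi0_zero _ _ S); rewrite -(epi_eq0 (iso_epi ii) pi).
Qed.

Lemma has_length_uniq X m n : has_length X m -> has_length X n -> m = n.
Proof.
elim: m X n => [|m IHm] X n; first by move/has_length0_zero/has_length_zero => H /H.
case/has_lengthS_inv => X' [S [i [p [ip Ss X'm]]]].
case/(has_length_ses ip) => a [c [<- X'a Sc]].
by rewrite (has_length_simple Ss Sc) addn1 (IHm _ _ X'm X'a).
Qed.

End Abelian.

Arguments im_proj_epi {k C X Y} f.
Arguments im_incl_mono {k C X Y} f.

(** * Additivity of length and ranks of morphisms *)

Section Length.
Variables (k : fieldType) (C : pretannakian_category k).
Implicit Types A B D P S T U W X Y Z : C.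

Lemma lenP X : has_length X (len X).
Proof. by rewrite /len; case: cid. Qed.

Lemma len_ses X Y Z (i : Mor X Y) (p : Mor Y Z) :
  short_exact i p -> len Y = (len X + len Z)%N.
Proof.
move/has_length_ses => /(_ _ (lenP Y)) [a [c [<- Xa Zc]]].
by rewrite (has_length_uniq Xa (lenP X)) (has_length_uniq Zc (lenP Z)).
Qed.

Lemma len_eq0 X : len X = 0%N <-> is_zero X.
Proof.
split=> [X0 | X0]; last by apply: has_length_zero X0 (lenP X).
by apply: has_length0_zero; rewrite -X0; apply: lenP.
Qed.

Lemma len_simple X : is_simple X -> len X = 1%N.
Proof. by move=> Xs; apply: has_length_simple Xs (lenP X). Qed.

Lemma len_mono X Y (f : Mor X Y) : is_mono f -> (len X <= len Y)%N.
Proof. by move=> fm; rewrite (len_ses (coker_ses fm)) leq_addr. Qed.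

Lemma len_epi X Y (f : Mor X Y) : is_epi f -> (len Y <= len X)%N.
Proof. by move=> fm; rewrite (len_ses (ker_ses fm)) leq_addl. Qed.

Lemma len_bip X Y : len (X ⊕ Y) = (len X + len Y)%N.
Proof.
apply: (@len_ses _ _ _ (inl_ X Y) (prr_ X Y)); split.
- by apply: (@mono_compr _ _ _ _ _ (prl_ X Y)); rewrite prl_inl; apply/iso_mono/iso_id.
- by apply: (@epi_compl _ _ _ _ _ _ (inr_ X Y)); rewrite prr_inr; apply/iso_epi/iso_id.
- exact: prr_inl.
- move=> T g g0; exists (prl_ X Y ∘ g); rewrite compA -[RHS]comp1m -bip_id.
  by rewrite compDl -!compA g0 compm0 addr0.
Qed.

Lemma len_dsum (I : Type) (F : I -> C) (s : seq I) :
  len (dsum F s) = (\sum_(i <- s) len (F i))%N.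
Proof.
elim: s => [|i s IHs] /=; first by rewrite big_nil; apply/len_eq0/zobj0.
by rewrite big_cons len_bip IHs.
Qed.

Definition rk X Y (f : Mor X Y) : nat := len (im f).

(** [m ∘ e] and [e] have the same kernel, so any epi-mono factorization has a middle object of
    length [len X - len (ker f)]. *)
Lemma rk_fact X I Y (e : Mor X I) (m : Mor I Y) :
  is_epi e -> is_mono m -> rk (m ∘ e) = len I.
Proof.
move=> ee mm; set f := m ∘ e.
have eker : e ∘ kerm f = 0 by apply: (mono_eq0 mm); rewrite compA kerm0.
have S1 : short_exact (kerm f) e.
  split=> //; first exact: kerm_mono.
  move=> T g eg; have fg : f ∘ g = 0 by rewrite -compA eg compm0.
  by exists (ker_lift fg); apply: ker_liftE.
apply: (@addnI (len (ker f))); rewrite -(len_ses S1).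
by rewrite -(len_ses (coker_ses (kerm_mono (f := f)))).
Qed.

Lemma rk_epi X Y (f : Mor X Y) : is_epi f -> rk f = len Y.
Proof. by move=> fe; rewrite -[f]comp1m rk_fact //; apply/iso_mono/iso_id. Qed.

Lemma rk_compr_epi X Y Z (f : Mor Y Z) (e : Mor X Y) : is_epi e -> rk (f ∘ e) = rk f.
Proof.
move=> ee; have [I [p [m [pe mm <-]]]] := im_fact f.
by rewrite -compA !rk_fact //; apply: epi_comp.
Qed.

Lemma rk_compl_mono X Y Z (m : Mor Y Z) (f : Mor X Y) : is_mono m -> rk (m ∘ f) = rk f.
Proof.
move=> mm; have [I [p [i [pe im <-]]]] := im_fact f.
by rewrite compA !rk_fact //; apply: mono_comp.
Qed.

Lemma rk_le_source X Y (f : Mor X Y) : (rk f <= len X)%N.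
Proof. exact: len_epi (im_proj_epi f). Qed.

Lemma rk_le_target X Y (f : Mor X Y) : (rk f <= len Y)%N.
Proof. exact: len_mono (im_incl_mono f). Qed.

Lemma rk_comp_l X Y Z (g : Mor Y Z) (f : Mor X Y) : (rk (g ∘ f) <= rk f)%N.
Proof.
by rewrite -[f in g ∘ f]im_projE compA rk_compr_epi ?rk_le_source //; apply: im_proj_epi.
Qed.

Lemma rk_comp_r X Y Z (g : Mor Y Z) (f : Mor X Y) : (rk (g ∘ f) <= rk g)%N.
Proof.
by rewrite -[g in g ∘ f]im_projE -compA rk_compl_mono ?rk_le_target //; apply: im_incl_mono.
Qed.

Lemma rk_eq0 X Y (f : Mor X Y) : rk f = 0%N <-> f = 0.
Proof.
split=> [/len_eq0 f0 | ->].
  by rewrite -[f]im_projE (zero_mor_to (im_proj f) f0) compm0.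
apply/len_eq0/(epi0_zero (X := X)).
suff <- : im_proj (0 : Mor X Y) = 0 by apply: im_proj_epi.
by apply: (im_incl_mono (0 : Mor X Y)); rewrite im_projE compm0.
Qed.

(** The image of [f ∘ g] lies in that of [f], and the quotient of the two is the image of [f] in the
    cokernel of [f ∘ g]. *)
Lemma rk_coker X Y T (f : Mor X Y) (g : Mor T X) :
  rk f = (rk (f ∘ g) + rk (cokerm (f ∘ g) ∘ f))%N.
Proof.
have [I [e [m [ee mm mef]]]] := im_fact f.
have [J [p [j [pe jm jp]]]] := im_fact (e ∘ g).
set c := cokerm (f ∘ g).
have fgE : f ∘ g = (m ∘ j) ∘ p by rewrite -compA jp compA mef.
have -> : rk (f ∘ g) = len J by rewrite fgE rk_fact //; apply: mono_comp.
have -> : rk (c ∘ f) = rk (c ∘ m).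
  have <- : c ∘ (m ∘ e) = c ∘ f by rewrite mef.
  by rewrite compA rk_compr_epi.
have -> : rk f = len I by rewrite -mef rk_fact.
have cmj : c ∘ m ∘ j = 0.
  by apply: (epi_eq0 pe); rewrite -!compA (compA m) -fgE cokerm0.
apply: (@len_ses _ _ _ j (im_proj (c ∘ m))); split=> //.
- exact: im_proj_epi.
- by apply: (mono_eq0 (im_incl_mono (c ∘ m))); rewrite compA im_projE.
move=> W t pt; have cmt : c ∘ m ∘ t = 0 by rewrite -(im_projE (c ∘ m)) -compA pt compm0.
have [|h mjh] := mono_normal (mono_comp mm jm) (g := m ∘ t).
  have d0 : cokerm (m ∘ j) ∘ (f ∘ g) = 0 by rewrite fgE compA cokerm0 comp0m.
  by rewrite -(coker_descE d0) -compA (compA c) cmt compm0.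
by exists h; apply: mm; rewrite compA.
Qed.

Lemma rk_chain X Y Z T (f : Mor X Y) (g : Mor T X) (h : Mor Y Z) :
  h ∘ (f ∘ g) = 0 -> (rk (f ∘ g) + rk (h ∘ f) <= rk f)%N.
Proof.
move=> hfg; rewrite (rk_coker f g) leq_add2l.
by rewrite -(coker_descE hfg) -compA rk_comp_l.
Qed.

Lemma rk_ker_le X Y Z (f : Mor X Y) (h : Mor X Z) :
  f ∘ kerm h = 0 -> (rk f <= rk h)%N.
Proof.
move=> fh; rewrite -(coker_descE fh).
by apply: leq_trans (rk_comp_r _ _) _; rewrite rk_le_source.
Qed.

End Length.

(** * Monoidal coherence and exactness of the tensor product *)

Section Monoidal.
Variables (k : fieldType) (C : tensor_category k).
Implicit Types A B D S T U W X Y Z : C.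
Local Notation "1" := (tunit C) : cat_scope.

Definition lunitV X : Mor X (1 ⊗ X) := sval (cid (lunit_iso X)).
Definition runitV X : Mor X (X ⊗ 1) := sval (cid (runit_iso X)).

Lemma lunitK X : lunitV X ∘ lunit X = idm _.
Proof. by rewrite /lunitV; case: cid => g []. Qed.
Lemma lunitVK X : lunit X ∘ lunitV X = idm _.
Proof. by rewrite /lunitV; case: cid => g []. Qed.
Lemma runitK X : runitV X ∘ runit X = idm _.
Proof. by rewrite /runitV; case: cid => g []. Qed.
Lemma runitVK X : runit X ∘ runitV X = idm _.
Proof. by rewrite /runitV; case: cid => g []. Qed.

Lemma runitV_iso X : is_iso (runitV X).
Proof. by exists (runit X); rewrite runitK runitVK. Qed.

Lemma lunitV_nat X Y (f : Mor X Y) : lunitV Y ∘ f = (idm 1 ⊠ f) ∘ lunitV X.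
Proof.
apply: (iso_mono (lunit_iso Y)).
by rewrite !compA lunitVK lunit_nat comp1m -compA lunitVK compm1.
Qed.

Lemma runitV_nat X Y (f : Mor X Y) : runitV Y ∘ f = (f ⊠ idm 1) ∘ runitV X.
Proof.
apply: (iso_mono (runit_iso Y)).
by rewrite !compA runitVK runit_nat comp1m -compA runitVK compm1.
Qed.

Lemma assoc_iso X Y Z : is_iso (assoc X Y Z).
Proof. by exists (assocV X Y Z); rewrite assocK assocVK. Qed.

Lemma braid_iso X Y : is_iso (braid X Y).
Proof. by exists (braid Y X); rewrite !braid_sym. Qed.

Lemma assocV_nat X X' Y Y' Z Z' (f : Mor X X') (g : Mor Y Y') (h : Mor Z Z') :
  assocV X' Y' Z' ∘ (f ⊠ (g ⊠ h)) = ((f ⊠ g) ⊠ h) ∘ assocV X Y Z.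
Proof.
apply: (iso_mono (assoc_iso X' Y' Z')).
by rewrite !compA assocVK assoc_nat comp1m -compA assocVK compm1.
Qed.

Lemma tensMl X Y Z A (g : Mor Y Z) (f : Mor X Y) :
  (g ∘ f) ⊠ idm A = (g ⊠ idm A) ∘ (f ⊠ idm A).
Proof. by rewrite -tensmM comp1m. Qed.

Lemma tensMr X Y Z A (g : Mor Y Z) (f : Mor X Y) :
  idm A ⊠ (g ∘ f) = (idm A ⊠ g) ∘ (idm A ⊠ f).
Proof. by rewrite -tensmM comp1m. Qed.

Lemma tens_lr X Y A B (f : Mor X Y) (g : Mor A B) :
  f ⊠ g = (f ⊠ idm B) ∘ (idm X ⊠ g).
Proof. by rewrite -tensmM comp1m compm1. Qed.

Lemma tens_rl X Y A B (f : Mor X Y) (g : Mor A B) :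
  f ⊠ g = (idm Y ⊠ g) ∘ (f ⊠ idm A).
Proof. by rewrite -tensmM comp1m compm1. Qed.

Lemma tens0m X Y A B (g : Mor A B) : (0 : Mor X Y) ⊠ g = 0.
Proof.
by have := tensm_linear_l g (-1) (0 : Mor X Y) 0; rewrite /= scaler0 addr0 scaleN1r addNr.
Qed.

Lemma tensm0 X Y A B (g : Mor A B) : g ⊠ (0 : Mor X Y) = 0.
Proof.
by have := tensm_linear_r g (-1) (0 : Mor X Y) 0; rewrite /= scaler0 addr0 scaleN1r addNr.
Qed.

Lemma tensDl X Y A B (f f' : Mor X Y) (g : Mor A B) :
  (f + f') ⊠ g = f ⊠ g + f' ⊠ g.
Proof. by have := tensm_linear_l g 1%R f f'; rewrite /= !scale1r. Qed.

Lemma tensDr X Y A B (f f' : Mor X Y) (g : Mor A B) :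
  g ⊠ (f + f') = g ⊠ f + g ⊠ f'.
Proof. by have := tensm_linear_r g 1%R f f'; rewrite /= !scale1r. Qed.

Lemma tensBl X Y A B (f f' : Mor X Y) (g : Mor A B) :
  (f - f') ⊠ g = f ⊠ g - f' ⊠ g.
Proof. by apply/eqP; rewrite eq_sym subr_eq -tensDl subrK. Qed.

Lemma tensBr X Y A B (f f' : Mor X Y) (g : Mor A B) :
  g ⊠ (f - f') = g ⊠ f - g ⊠ f'.
Proof. by apply/eqP; rewrite eq_sym subr_eq -tensDr subrK. Qed.

Lemma tens_iso X Y A B (f : Mor X Y) (g : Mor A B) :
  is_iso f -> is_iso g -> is_iso (f ⊠ g).
Proof.
move=> [f' [fK Kf]] [g' [gK Kg]]; exists (f' ⊠ g').
by rewrite -!tensmM fK gK Kf Kg !tensm1.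
Qed.

Lemma tens1_inj X Y (f g : Mor X Y) : idm 1 ⊠ f = idm 1 ⊠ g -> f = g.
Proof.
move=> fg; apply: (iso_epi (lunit_iso X)).
by rewrite -!lunit_nat fg.
Qed.

Lemma tensr1_inj X Y (f g : Mor X Y) : f ⊠ idm 1 = g ⊠ idm 1 -> f = g.
Proof.
move=> fg; apply: (iso_epi (runit_iso X)).
by rewrite -!runit_nat fg.
Qed.

(* Kelly's argument deriving the remaining unit coherences from the pentagon and
   the triangle. *)
Lemma lunit_assoc X Y : lunit (X ⊗ Y) ∘ assoc 1 X Y = lunit X ⊠ idm Y.
Proof.
apply: tens1_inj; set E := assoc 1 (1 ⊗ X) Y ∘ (assoc 1 1 X ⊠ idm Y).
have Ei : is_iso E.
  by apply: iso_comp; [apply: assoc_iso | apply: tens_iso (assoc_iso _ _ _) (iso_id _)].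
apply: (iso_epi Ei); rewrite /E.
rewrite tensMr -compA (compA _ _ (assoc 1 1 X ⊠ _)) -pentagon compA triangle.
rewrite -[in LHS]tensm1 -assoc_nat -triangle compA -assoc_nat -compA.
by rewrite tensMl.
Qed.

Lemma runit_assoc X Y : (idm X ⊠ runit Y) ∘ assoc X Y 1 = runit (X ⊗ Y).
Proof.
apply: tensr1_inj; apply: (iso_mono (assoc_iso X Y 1)).
rewrite tensMl compA assoc_nat -triangle tensMr -compA -compA (compA (idm X ⊠ assoc _ _ _)).
by rewrite -pentagon !compA -assoc_nat tensm1 -compA triangle.
Qed.

(** The hexagon at [X, 1, 1], followed by [lunit], becomes this identity tensored with the unit and
    followed by a braiding, both of which can be cancelled. *)
Lemma lunit_braid X : lunit X ∘ braid X 1 = runit X.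
Proof.
apply: tensr1_inj; apply: (iso_mono (braid_iso X 1)).
have := congr1 (fun h => lunit (1 ⊗ X) ∘ h) (hexagon X 1 1).
rewrite !compA lunit_assoc -braid_nat -compA triangle => ->.
by rewrite lunit_nat -!compA (compA _ (assoc _ _ _)) lunit_assoc tensMl.
Qed.

Lemma runit_braid X : runit X ∘ braid 1 X = lunit X.
Proof. by rewrite -lunit_braid -compA braid_sym compm1. Qed.

Section Duality.
Variables (X D : C) (ev : Mor (D ⊗ X) 1) (coev : Mor 1 (X ⊗ D)).
Hypothesis zigzag : runit X ∘ (idm X ⊠ ev) ∘ assoc X D X ∘ (coev ⊠ idm X) = lunit X.

(** The functor [D ⊗ -] is left adjoint to [X ⊗ -]. Only what cancellation arguments use is
    recorded: naturality of the counit, and that [u] is recovered from its transpose. The next lemma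
    does the same for [- ⊗ X] and its right adjoint [- ⊗ D]. *)
Lemma tens_left_adjoint :
  exists (eta : forall T, Mor T (X ⊗ (D ⊗ T))) (eps : forall A, Mor (D ⊗ (X ⊗ A)) A),
    (forall A B (f : Mor A B), f ∘ eps A = eps B ∘ (idm D ⊠ (idm X ⊠ f))) /\
    forall T A (u : Mor T (X ⊗ A)),
      u = (idm X ⊠ (eps A ∘ (idm D ⊠ u))) ∘ eta T.
Proof.
exists (fun T => assoc X D T ∘ (coev ⊠ idm T) ∘ lunitV T).
exists (fun A => lunit A ∘ (ev ⊠ idm A) ∘ assocV D X A).
split=> [A B f | T A u].
  rewrite -!compA assocV_nat tensm1 (compAE (esym (tens_lr _ _))) (tens_rl ev f) -!compA.
  by rewrite (compAE (lunit_nat _)) !compA.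
suff E : (idm X ⊠ (lunit A ∘ (ev ⊠ idm A) ∘ assocV D X A)) ∘ assoc X D (X ⊗ A)
    ∘ (coev ⊠ idm (X ⊗ A)) = lunit (X ⊗ A).
  rewrite tensMr -!compA (compAE (esym (assoc_nat _ _ _))) tensm1 -!compA.
  rewrite (compAE (esym (tens_rl _ _))) (tens_lr coev) -!compA -lunitV_nat.
  by rewrite !compA E lunitVK comp1m.
apply: (iso_epi (assoc_iso 1 X A)); rewrite lunit_assoc -zigzag.
rewrite -!compA -[X in coev ⊠ X]tensm1 -assoc_nat (compAE (pentagon _ _ _ _)).
have aK : (idm X ⊠ assocV D X A) ∘ (idm X ⊠ assoc D X A) = idm _.
  by rewrite -tensMr assocK tensm1.
rewrite !tensMr -!compA (compAE aK) comp1m (compAE (esym (assoc_nat _ _ _))) -!compA.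
by rewrite (compAE (triangle _ _)) -!tensMl.
Qed.

Lemma tens_right_adjoint :
  exists (eta : forall B, Mor B ((B ⊗ X) ⊗ D)) (eps : forall T, Mor ((T ⊗ D) ⊗ X) T),
    (forall A B (f : Mor A B), eta B ∘ f = ((f ⊠ idm X) ⊠ idm D) ∘ eta A) /\
    forall B T (g : Mor (B ⊗ X) T),
      g = eps T ∘ (((g ⊠ idm D) ∘ eta B) ⊠ idm X).
Proof.
exists (fun B => assocV B X D ∘ (idm B ⊠ coev) ∘ runitV B).
exists (fun T => runit T ∘ (idm T ⊠ ev) ∘ assoc T D X).
split=> [A B f | B T g].
  rewrite -!compA runitV_nat (compAE (esym (tens_rl _ _))) (tens_lr f) -!compA.
  by rewrite -tensm1 (compAE (assocV_nat _ _ _)) -!compA.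
suff E : runit (B ⊗ X) ∘ ((idm (B ⊗ X) ⊠ ev) ∘ (assoc (B ⊗ X) D X
    ∘ ((assocV B X D ⊠ idm X) ∘ (((idm B ⊠ coev) ⊠ idm X) ∘ (runitV B ⊠ idm X))))) = idm _.
  rewrite !tensMl -!compA (compAE (assoc_nat _ _ _)) tensm1 -!compA.
  rewrite (compAE (esym (tens_rl _ _))) (tens_lr g) -!compA (compAE (runit_nat _)) -!compA.
  by rewrite E compm1.
have zz : (idm B ⊠ runit X) ∘ ((idm B ⊠ (idm X ⊠ ev)) ∘ ((idm B ⊠ assoc X D X)
    ∘ (idm B ⊠ (coev ⊠ idm X)))) = idm B ⊠ lunit X.
  by rewrite -!tensMr -zigzag !compA.
have aK : (assoc B X D ⊠ idm X) ∘ (assocV B X D ⊠ idm X) = idm _.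
  by rewrite -tensMl assocVK tensm1.
rewrite -runit_assoc -[X in X ⊠ ev]tensm1 -!compA (compAE (assoc_nat _ _ _)) -!compA.
rewrite (compAE (pentagon _ _ _ _)) -!compA (compAE aK) comp1m (compAE (assoc_nat _ _ _)).
have := congr1 (fun h => h ∘ (assoc B 1 X ∘ (runitV B ⊠ idm X))) zz.
rewrite /= -!compA (compAE (triangle _ _)) => ->.
by rewrite -tensMl runitVK tensm1.
Qed.

End Duality.

Section Exactness.
Variable X : C.

Lemma tensr_mono A B (i : Mor A B) : is_mono i -> is_mono (idm X ⊠ i).
Proof.
move=> im; apply/mono_cancel0 => T u iu; have [E [ev [coev [zz _]]]] := rigid X.
have [eta [eps [epsN epsE]]] := tens_left_adjoint zz.
rewrite [u]epsE (_ : eps A ∘ _ = 0) ?tensm0 ?comp0m //.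
by apply: (mono_eq0 im); rewrite compA epsN -compA -tensMr iu tensm0 compm0.
Qed.

(** A left adjoint preserves cokernels. Only the existence half of the universal property is
    transported, uniqueness being the separate statement about epis. *)
Lemma tensl_desc A B D (i : Mor A B) (p : Mor B D) :
  (forall W (g : Mor B W), g ∘ i = 0 -> exists h, h ∘ p = g) ->
  forall W (g : Mor (B ⊗ X) W), g ∘ (i ⊠ idm X) = 0 -> exists h, h ∘ (p ⊠ idm X) = g.
Proof.
move=> desc W g gi; have [E [ev [coev [zz _]]]] := rigid X.
have [eta [eps [etaN etaE]]] := tens_right_adjoint zz.
have [|h hp] := desc _ ((g ⊠ idm E) ∘ eta B).
  by rewrite -compA etaN compA -tensMl gi tens0m comp0m.
by exists (eps W ∘ (h ⊠ idm X)); rewrite [RHS]etaE -hp tensMl compA.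
Qed.

Lemma tensl_epi A B (p : Mor A B) : is_epi p -> is_epi (p ⊠ idm X).
Proof.
move=> pe; apply/epi_cancel0 => W g gp; have [E [ev [coev [zz _]]]] := rigid X.
have [eta [eps [etaN etaE]]] := tens_right_adjoint zz.
rewrite [g]etaE (_ : _ ∘ eta B = 0) ?tens0m ?compm0 //.
by apply: (epi_eq0 pe); rewrite -compA etaN compA -tensMl gp tens0m comp0m.
Qed.

Lemma tensr_desc A B D (i : Mor A B) (p : Mor B D) :
  (forall W (g : Mor B W), g ∘ i = 0 -> exists h, h ∘ p = g) ->
  forall W (g : Mor (X ⊗ B) W), g ∘ (idm X ⊠ i) = 0 -> exists h, h ∘ (idm X ⊠ p) = g.
Proof.
move=> desc W g gi; have [|h hp] := tensl_desc desc (g := g ∘ braid B X).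
  by rewrite -compA braid_nat compA gi comp0m.
exists (h ∘ braid X D); rewrite -compA braid_nat compA hp -compA braid_sym.
exact: compm1.
Qed.

Lemma tensr_epi A B (p : Mor A B) : is_epi p -> is_epi (idm X ⊠ p).
Proof.
move=> pe; apply: (@epi_compl _ _ _ _ _ _ (braid A X)).
by rewrite -braid_nat; apply: epi_comp (iso_epi (braid_iso _ _)) (tensl_epi pe).
Qed.

End Exactness.

Lemma tens_epi X Y A B (f : Mor X Y) (g : Mor A B) :
  is_epi f -> is_epi g -> is_epi (f ⊠ g).
Proof. by move=> fe ge; rewrite tens_lr; apply: epi_comp (tensl_epi fe) (tensr_epi ge). Qed.

End Monoidal.

Lemma simple_iso (k : fieldType) (C : linear_category k) (X Y : C) (f : Mor X Y) :
  is_iso f -> is_simple Y -> is_simple X.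
Proof.
move=> fi [Y0 Ys]; split=> [X0 | Z g gm].
  by apply: Y0; apply: epi_zero (iso_epi fi) X0.
case: (Ys _ _ (mono_comp (iso_mono fi) gm)) => [|fgi]; [by left | right].
have [f' [f'f ff']] := fi.
rewrite -[g]comp1m -f'f -compA; apply: iso_comp fgi.
by exists f.
Qed.

(** * Simplicity of the unit object *)

Section Unit.
Variables (k : fieldType) (C : pretannakian_category k).
Implicit Types A B D S T U W X Y Z : C.
Local Notation "1" := (tunit C) : cat_scope.

Lemma unit_nonzero : ~ is_zero (tunit C).
Proof.
move=> Z; have /bij_inj/(_ 1%R 0%R) := unit_scalars C.
by rewrite Z !scaler0 => /(_ erefl)/eqP; rewrite oner_eq0.
Qed.

Lemma unit_scalar (f : Mor (tunit C) (tunit C)) : exists a : k, f = a *: idm 1.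
Proof. by have [g _ gK] := unit_scalars C; exists (g f); rewrite gK. Qed.

Lemma simple_quotient X : ~ is_zero X -> exists S (p : Mor X S), is_simple S /\ is_epi p.
Proof.
move=> X0; have := lenP X; case: (len X) => [/has_length0_zero // | n].
by case/has_lengthS_inv => Y [S [i [p [[_ pe _ _] Ss _]]]]; exists S, p.
Qed.

(* For a simple quotient [p : 1 -> S] the mono [S ⊗ p^*] shows [S ⊗ S^* = S]; the
   evaluation then provides a nonzero map [S -> 1], so that [p] splits. *)
Lemma unit_simple : is_simple (tunit C).
Proof.
have [S [p [Ss pe]]] := simple_quotient unit_nonzero.
have [D [ev [coev [zz1 zz2]]]] := rigid S.
pose q := ev ∘ (idm D ⊠ p) ∘ runitV D.
(* [q] is the transpose of [p]. If [q ∘ x = 0], then [ev ∘ (x ⊠ idm S)] vanishes after the epi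
   [idm T ⊠ p], hence is zero, and the second zigzag identity recovers [x] from it. *)
have qm : is_mono q.
  apply/mono_cancel0 => T x; rewrite /q -!compA runitV_nat => qx0.
  have ex0 : ev ∘ (x ⊠ idm S) = 0.
    apply: (epi_eq0 (tensr_epi (X := T) pe)); rewrite -compA -tens_lr tens_rl.
    apply: (epi_eq0 (iso_epi (runitV_iso T))).
    by rewrite -!compA.
  apply: (epi_eq0 (iso_epi (runit_iso T))); rewrite -runit_nat -zz2 -!compA.
  rewrite -tens_rl (tens_lr x coev) -[idm (S ⊗ D)]tensm1 (compAE (assocV_nat _ _ _)) -!compA.
  by rewrite (compAE (esym (tensMl _ _ _))) ex0 tens0m comp0m compm0.
pose r := runit S ∘ (idm S ⊠ q).
have rm : is_mono r by apply: mono_comp (iso_mono (runit_iso S)) (tensr_mono qm).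
have SD0 : ~ is_zero (S ⊗ D).
  move=> Z; apply: Ss.1; apply: epi_zero (iso_epi (lunit_iso S)) _.
  apply: (@mono0_zero _ _ (1 ⊗ S) S).
  have <- : lunit S = 0.
    by rewrite -zz1 (zero_mor_to coev Z) tens0m compm0.
  exact/iso_mono/lunit_iso.
have [SD | [r' [r'r rr']]] := Ss.2 _ _ rm; first by case: SD0.
have ev0 : ev <> 0.
  move=> ev0; apply: Ss.1; apply: (epi0_zero (X := 1 ⊗ S)).
  have <- : lunit S = 0 by rewrite -zz1 ev0 tensm0 compm0 !comp0m.
  exact/iso_epi/lunit_iso.
pose h := ev ∘ braid S D ∘ r' ∘ p.
have [a ha] := unit_scalar h.
have a0 : a != 0.
  apply/eqP => a0; apply: ev0.
  apply: (epi_eq0 (iso_epi (braid_iso S D))).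
  apply: (epi_eq0 (f := r')); first by apply: iso_epi; exists r.
  by apply: (epi_eq0 pe); rewrite -/h ha a0 scale0r.
have pm : is_mono p.
  apply: (@mono_compr _ _ _ _ _ (ev ∘ braid S D ∘ r')); rewrite -/h ha.
  apply/mono_cancel0 => T u; rewrite compZl comp1m => au.
  by rewrite -[u]scale1r -(mulVf a0) -scalerA au scaler0.
exact: simple_iso (mono_epi_iso pm pe) Ss.
Qed.

Lemma nonzero_to_unit X (f : Mor X 1) : f <> 0 -> is_epi f.
Proof. exact: nonzero_to_simple unit_simple. Qed.

Lemma len_unit : len 1 = 1%N.
Proof. exact: len_simple unit_simple. Qed.

Lemma epi_to_unit_neq0 X (f : Mor X 1) : is_epi f -> f <> 0.
Proof. by move=> fe f0; apply: unit_nonzero; apply: (@epi0_zero _ _ X); rewrite -f0. Qed.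

End Unit.

(** * Symmetric powers *)

Section Swaps.
Variables (k : fieldType) (C : tensor_category k).
Implicit Types A B D S T U W X Y Z : C.

(** The swap of the factors [i] and [i + 1]. An index out of range gives the identity, so that
    [swap_invariant] can quantify over all [i]. *)
Fixpoint adj X n i : Mor (tpow X n) (tpow X n) :=
  match n with
  | 0 => idm _
  | n'.+1 => match i with
    | 0 => match n' return Mor (tpow X n'.+1) (tpow X n'.+1) with
           | 0 => idm _
           | m.+1 => tswap X (tpow X m)
           end
    | i'.+1 => idm X ⊠ adj X n' i'
    end
  end.

Definition swap_invariant X n T (g : Mor (tpow X n) T) : Prop :=
  forall i, g ∘ adj X n i = g.

(** The monoid generated by the adjacent swaps, standing in for the symmetric group without any
    relation between its generators. *)
Inductive swaps X n : Mor (tpow X n) (tpow X n) -> Prop :=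
| swaps1 : swaps (idm _)
| swapsM i s : swaps s -> swaps (adj X n i ∘ s).

Lemma swap_invariantP X n T (g : Mor (tpow X n) T) s :
  swap_invariant g -> swaps s -> g ∘ s = g.
Proof.
move=> gi; elim=> [|i {}s _ IH]; first exact: compm1.
by rewrite compA gi.
Qed.

Lemma swaps_comp X n (s t : Mor (tpow X n) (tpow X n)) :
  swaps s -> swaps t -> swaps (s ∘ t).
Proof.
move=> + ts; elim=> [|i {}s _ IH]; first by rewrite comp1m.
by rewrite -compA; apply: swapsM.
Qed.

Lemma swaps_tens X n (s : Mor (tpow X n) (tpow X n)) :
  swaps s -> swaps (idm X ⊠ s : Mor (tpow X n.+1) (tpow X n.+1)).
Proof.
elim=> [|i {}s _ IH]; first by rewrite tensm1; apply: swaps1.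
by rewrite tensMr; apply: (@swapsM X n.+1 i.+1).
Qed.

Lemma tmove0 X n : tmove X n 0 = idm _.
Proof. by case: n. Qed.

Lemma swaps_tmove X n i : swaps (tmove X n i : Mor (tpow X n.+1) (tpow X n.+1)).
Proof.
elim: n i => [|n IHn] [|i]; try exact: swaps1.
apply: swaps_comp; first exact: swaps_tens (IHn i).
rewrite -[tswap _ _]compm1; apply: (@swapsM X n.+2 0); exact: swaps1.
Qed.

Lemma swaps_tperm_act X n (s : 'I_n -> 'I_n) : swaps (tperm_act X s).
Proof.
elim: n s => [|n IHn] s /=; first exact: swaps1.
by apply: swaps_comp; [apply: swaps_tmove | apply: swaps_tens].
Qed.

Lemma tperm_act_id X n (s : 'I_n -> 'I_n) : s =1 id -> tperm_act X s = idm _.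
Proof.
elim: n s => [//|n IHn] s sid /=; rewrite sid IHn => [|j].
  by rewrite tensm1 tmove0 comp1m.
by rewrite sid liftK.
Qed.

Lemma tperm_actS X n (s : 'I_n.+1 -> 'I_n.+1) :
  tperm_act X s = tmove X n (s ord0) ∘
    (idm X ⊠ tperm_act X (fun j => odflt j (unlift (s ord0) (s (lift ord0 j))))).
Proof. by []. Qed.

(** With [swaps_tperm_act] this shows that the relations imposed by all permutations and by the
    adjacent swaps are the same. *)
Lemma adj_tperm_act X n i : exists s : 'S_n, tperm_act X s = adj X n i.
Proof.
elim: n i => [|n IHn] i; first by exists 1%g.
case: i => [|i]; last first.
  have [s sE] := IHn i; exists (lift_perm ord0 ord0 s).
  rewrite tperm_actS /= -sE lift_perm_id tmove0 comp1m; congr (_ ⊠ tperm_act X _).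
  by apply: funext => j; rewrite lift_perm_lift liftK.
case: n {IHn} => [|n].
  by exists 1%g; apply: (@tperm_act_id X 1) => j; rewrite perm1.
pose h : 'I_n.+2 := lift ord0 ord0.
have mE : tmove X n.+1 h = tswap X (tpow X n).
  by rewrite (_ : nat_of_ord h = 1%N) //= tmove0 tensm1 comp1m.
exists (tperm ord0 h); rewrite tperm_actS tpermL mE.
rewrite (@tperm_act_id X n.+1) => [|j]; first by rewrite tensm1 compm1.
suff -> : tperm ord0 h (lift ord0 j) = lift h j by rewrite liftK.
case: (unliftP ord0 j) => [j' ->|->]; last by rewrite tpermR; apply: val_inj.
by rewrite tpermD; apply: val_inj || apply/eqP.
Qed.

Definition symq X n : Mor (tpow X n) (Sym X n) := cokerm (sym_rel X n).

Lemma symq_epi X n : is_epi (symq X n).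
Proof. exact: cokerm_epi. Qed.

Lemma symq_swap X n : swap_invariant (symq X n).
Proof.
move=> i; have [s <-] := adj_tperm_act X n i.
have /dsum_copair_eq0 H : dsum_copair (fun s : 'S_n => symq X n ∘ (tperm_act X s - idm _))
    (enum 'S_n) = 0 by rewrite -comp_dsum_copair cokerm0.
have := H s; rewrite mem_enum => /(_ isT)/eqP.
by rewrite compBr compm1 subr_eq0 => /eqP.
Qed.

Lemma sym_rel_eq0 X n T (g : Mor (tpow X n) T) :
  (forall s : 'I_n -> 'I_n, g ∘ tperm_act X s = g) -> g ∘ sym_rel X n = 0.
Proof.
move=> gs; rewrite comp_dsum_copair; apply/dsum_copair_eq0 => s _.
by rewrite compBr compm1 gs subrr.
Qed.

(** Every [tperm_act] is a product of adjacent swaps, so invariance under these is enough to factor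
    through the coinvariants. *)
Lemma sym_desc X n T (g : Mor (tpow X n) T) :
  swap_invariant g -> exists h, h ∘ symq X n = g.
Proof.
move=> gi; have g0 : g ∘ sym_rel X n = 0.
  by apply: sym_rel_eq0 => s; apply: swap_invariantP gi (swaps_tperm_act _ _).
by exists (coker_desc g0); apply: coker_descE.
Qed.

Lemma tpowmM X Y Z (g : Mor Y Z) (f : Mor X Y) n :
  tpowm (g ∘ f) n = tpowm g n ∘ tpowm f n.
Proof. by elim: n => [|n /= ->]; rewrite ?comp1m ?tensmM. Qed.

Lemma tpowm1 X n : tpowm (idm X) n = idm _.
Proof. by elim: n => [|n /= ->] //; rewrite tensm1. Qed.

Lemma SymmE X Y (f : Mor X Y) n : Symm f n ∘ symq X n = symq Y n ∘ tpowm f n.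
Proof. exact: coker_descE. Qed.

Lemma symq_mul X n : exists h, h ∘ (idm X ⊠ symq X n) = symq X n.+1.
Proof.
apply: (tensr_desc (i := sym_rel X n)).
  by move=> W g g0; exists (coker_desc g0); apply: coker_descE.
(* The tensor product is distributed over the direct sum defining [sym_rel] by induction on the list
   of permutations. *)
suff : forall s : seq 'S_n, symq X n.+1 ∘
    (idm X ⊠ dsum_copair (fun s : 'S_n => tperm_act X s - idm _) s) = 0 by apply.
elim=> [|s l IHl] /=; first by rewrite tensm0 compm0.
rewrite tensDr compDr !tensMr (compA _ _ (idm X ⊠ prr_ _ _)) IHl comp0m addr0.
rewrite tensBr compA compBr tensm1 compm1.
rewrite (swap_invariantP (@symq_swap X n.+1)) ?subrr ?comp0m //.
exact: swaps_tens (swaps_tperm_act _ _).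
Qed.

Fixpoint tmul X m n : Mor (tpow X m ⊗ tpow X n) (tpow X (m + n)) :=
  match m with
  | 0 => lunit (tpow X n)
  | m'.+1 => (idm X ⊠ tmul X m' n) ∘ assoc X (tpow X m') (tpow X n)
  end.

(** The swap on the right cannot simply be [adj X (m + n) i]: for [i = m - 1] the left-hand [adj] is
    the identity, while that one would exchange factors across the boundary. Hence the unspecified
    [s]. *)
Lemma tmul_adj X m n i : exists2 s, swaps s &
  tmul X m n ∘ (adj X m i ⊠ idm _) = s ∘ tmul X m n.
Proof.
elim: m i => [|m IHm] i /=.
  by exists (idm _); [apply: swaps1 | rewrite tensm1 comp1m compm1].
case: i => [|i].
  case: m {IHm} => [|m].
    by exists (idm _); [apply: swaps1 | rewrite tensm1 comp1m compm1].
  exists (tswap X (tpow X (m + n))).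
    by rewrite -[tswap _ _]compm1; apply: (@swapsM X (m + n).+2 0); apply: swaps1.
  rewrite /=; set Y := tpow X m; set T := tpow X n.
  have aK : (assoc X X Y ⊠ idm T) ∘ (assocV X X Y ⊠ idm T) = idm _.
    by rewrite -tensMl assocVK tensm1.
  have E : assocV X X (Y ⊗ T) ∘ ((idm X ⊠ assoc X Y T) ∘ assoc X (X ⊗ Y) T)
      = assoc (X ⊗ X) Y T ∘ (assocV X X Y ⊠ idm T).
    apply: (iso_mono (assoc_iso X X (Y ⊗ T))).
    by rewrite (compA (assoc _ _ _)) assocVK comp1m (compAE (pentagon _ _ _ _))
      -!compA aK compm1.
  have F : (idm X ⊠ assoc X Y T) ∘ (assoc X (X ⊗ Y) T ∘ (tswap X Y ⊠ idm T))
      = tswap X (Y ⊗ T) ∘ ((idm X ⊠ assoc X Y T) ∘ assoc X (X ⊗ Y) T).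
    rewrite /tswap -!compA E !tensMl !compA -pentagon -!compA.
    by rewrite (compAE (assoc_nat _ _ _)) tensm1 -!compA.
  by rewrite tensMr -!compA F (compAE (esym (tswap_nat _ _))) -!compA.
have [s ss sE] := IHm i; exists (idm X ⊠ s); first exact: swaps_tens.
by rewrite -compA assoc_nat !compA -!tensMr sE.
Qed.

Lemma symq_tmul X m n :
  exists h, h ∘ (symq X m ⊠ idm (tpow X n)) = symq X (m + n) ∘ tmul X m n.
Proof.
apply: (tensl_desc (i := sym_rel X m)).
  by move=> W g g0; exists (coker_desc g0); apply: coker_descE.
have inv s : swaps s ->
    symq X (m + n) ∘ tmul X m n ∘ (s ⊠ idm (tpow X n)) = symq X (m + n) ∘ tmul X m n.
  elim=> [|i {}s _ IH]; first by rewrite tensm1 compm1.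
  have [t tt E] := tmul_adj X m n i.
  by rewrite tensMl compA -(compA _ (tmul _ _ _)) E compA
    (swap_invariantP (@symq_swap _ _) tt) IH.
set g := symq X (m + n) ∘ _ in inv *.
suff : forall s : seq 'S_m, g ∘
    (dsum_copair (fun s : 'S_m => tperm_act X s - idm _) s ⊠ idm _) = 0 by apply.
elim=> [|s l IHl] /=; first by rewrite tens0m compm0.
rewrite tensDl compDr !tensMl (compA _ _ (prr_ _ _ ⊠ _)) IHl comp0m addr0.
rewrite tensBl compA compBr tensm1 compm1.
by rewrite inv ?subrr ?comp0m //; apply: swaps_tperm_act.
Qed.

End Swaps.

(** * Contraction with a map to the unit *)

Section Contraction.
Variables (k : fieldType) (C : tensor_category k).
Implicit Types A B D S T U W X Y Z : C.
Local Notation "1" := (tunit C) : cat_scope.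

Definition gswap X Y Z : Mor (X ⊗ (Y ⊗ Z)) (Y ⊗ (X ⊗ Z)) :=
  assoc Y X Z ∘ (braid X Y ⊠ idm Z) ∘ assocV X Y Z.

Lemma gswap_nat X X' Y Y' Z Z' (f : Mor X X') (g : Mor Y Y') (h : Mor Z Z') :
  gswap X' Y' Z' ∘ (f ⊠ (g ⊠ h)) = (g ⊠ (f ⊠ h)) ∘ gswap X Y Z.
Proof.
rewrite /gswap -!compA assocV_nat (compAE (esym (tensmM _ _ _ _))) braid_nat comp1m.
by rewrite -[h in LHS]compm1 tensmM -!compA (compAE (assoc_nat _ _ _)) -!compA.
Qed.

Lemma gswapK X Y Z : gswap Y X Z ∘ gswap X Y Z = idm _.
Proof.
rewrite /gswap -!compA (compAE (assocK _ _ _)) comp1m (compAE (esym (tensMl _ _ _))).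
by rewrite braid_sym tensm1 comp1m assocVK.
Qed.

Lemma lunit_gswap Y Z : (idm Y ⊠ lunit Z) ∘ gswap 1 Y Z = lunit (Y ⊗ Z).
Proof.
rewrite /gswap -!compA (compAE (triangle _ _)) (compAE (esym (tensMl _ _ _))).
by rewrite runit_braid -lunit_assoc -compA assocVK compm1.
Qed.

Definition evl X Y T (f : Mor X 1) (g : Mor Y T) : Mor (X ⊗ Y) T := lunit T ∘ (f ⊠ g).

Lemma comp_evl X Y T U (f : Mor X 1) (g : Mor Y T) (h : Mor T U) :
  h ∘ evl f g = evl f (h ∘ g).
Proof. by rewrite /evl compA -lunit_nat -compA -tensmM comp1m. Qed.

Lemma evl_tens X X' Y Y' T (f : Mor X 1) (g : Mor Y T) (u : Mor X' X) (v : Mor Y' Y) :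
  evl f g ∘ (u ⊠ v) = evl (f ∘ u) (g ∘ v).
Proof. by rewrite /evl -compA -tensmM. Qed.

Lemma evlDr X Y T (f : Mor X 1) (g h : Mor Y T) : evl f (g + h) = evl f g + evl f h.
Proof. by rewrite /evl tensDr compDr. Qed.

Lemma evl0 X Y T (g : Mor Y T) : evl (0 : Mor X 1) g = 0.
Proof. by rewrite /evl tens0m compm0. Qed.

Lemma evl_epi X Y T (f : Mor X 1) (g : Mor Y T) : is_epi f -> is_epi g -> is_epi (evl f g).
Proof. by move=> fe ge; apply: epi_comp (iso_epi (lunit_iso T)) (tens_epi fe ge). Qed.

Lemma evl_evl_swap X X' Y T (f : Mor X 1) (f' : Mor X' 1) (g : Mor Y T) :
  evl f (evl f' g) ∘ gswap X' X Y = evl f' (evl f g).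
Proof.
have E U V (h : Mor U 1) (h' : Mor V 1) : evl h (evl h' g) =
    lunit T ∘ (lunit (1 ⊗ T) ∘ (h ⊠ (h' ⊠ g))).
  by rewrite (compA (lunit T)) -lunit_nat -compA -tensmM comp1m.
have F : lunit T ∘ (lunit (1 ⊗ T) ∘ gswap 1 1 T) = lunit T ∘ lunit (1 ⊗ T).
  by rewrite compA -lunit_nat -compA lunit_gswap lunit_nat.
by rewrite !E -!compA -gswap_nat (compA (lunit (1 ⊗ T))) compA F -compA.
Qed.

Lemma tens_evl_swap A X Y T (f : Mor X 1) (g : Mor Y T) :
  (idm A ⊠ evl f g) ∘ gswap X A Y = evl f (idm A ⊠ g).
Proof. by rewrite /evl tensMr -compA -gswap_nat compA lunit_gswap. Qed.

Lemma evl_tens_swap A X Y T (f : Mor X 1) (g : Mor Y T) :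
  evl f (idm A ⊠ g) ∘ gswap A X Y = idm A ⊠ evl f g.
Proof. by rewrite -tens_evl_swap -compA gswapK compm1. Qed.

(* The coefficients of [x1 ... xn |-> (x1 + f x1) ... (xn + f xn)]: [contr f n m] sums,
   over the m-element subsets of the factors, the application of [f] to the others.
   It plays the role of the divided power of order [n - m] of the derivation [f]. *)
Fixpoint contr X (f : Mor X 1) n m : Mor (tpow X n) (tpow X m) :=
  match n return Mor (tpow X n) (tpow X m) with
  | 0 => match m return Mor 1 (tpow X m) with
         | 0 => idm 1
         | _.+1 => 0
         end
  | n'.+1 => match m return Mor (X ⊗ tpow X n') (tpow X m) with
             | 0 => evl f (contr f n' 0)
             | m'.+1 => (idm X ⊠ contr f n' m') + evl f (contr f n' m'.+1)
             end
  end.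

(** For the first two factors, the swap exchanges the terms contracting exactly one of them and
    fixes the term contracting both; in the term keeping both it becomes a swap in the target,
    absorbed by [symq]. Later swaps are handled by induction, through the multiplication
    [symq_mul]. *)
Lemma contr_swap X (f : Mor X 1) n m : swap_invariant (symq X m ∘ contr f n m).
Proof.
move=> i; elim: n m i => [|n IHn] m i; first exact: compm1.
case: i => [|i]; last first.
  case: m => [|m] /=.
    by rewrite !comp_evl evl_tens compm1 IHn.
  rewrite !compDr compDl !comp_evl evl_tens compm1 IHn.
  have [h <-] := symq_mul X m.
  by rewrite -!compA -!tensMr compA IHn.
case: n {IHn} => [|n]; first exact: compm1.
rewrite -[adj _ _ _]/(gswap X X (tpow X n)); case: m => [|[|m]] /=.
- by rewrite -compA evl_evl_swap.
- rewrite -compA !compDl tens_evl_swap !evlDr compDl evl_evl_swap evl_tens_swap.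
  by rewrite addrCA.
- rewrite -compA !compDl tensDr !compDl tens_evl_swap !evlDr compDl evl_evl_swap.
  rewrite evl_tens_swap -!addrA !compDr; congr (_ + _); last first.
    by rewrite addrCA.
  rewrite -gswap_nat compA; congr (_ ∘ _).
  exact: (@symq_swap _ _ X m.+2 0).
Qed.

End Contraction.

(** * Tensor powers with [m] factors [W] followed by factors [Z] *)

Section Mixed.
Variables (k : fieldType) (C : tensor_category k).
Implicit Types A B D S T U W X Y Z : C.
Local Notation "1" := (tunit C) : cat_scope.

(** This is $W^{\otimes m}\otimes Z^{\otimes(n-m)}$, nested like [tpow] so that it maps to
    [tpow X n] without associators or subtraction. For [m > n] it consists of [n] factors [W]. *)
Fixpoint mix W Z m n : C :=
  match m with
  | 0 => tpow Z n
  | m'.+1 => if n is n'.+1 then W ⊗ mix W Z m' n' else 1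
  end.

Fixpoint mixm W Z X (u : Mor W X) (z : Mor Z X) m n : Mor (mix W Z m n) (tpow X n) :=
  match m with
  | 0 => tpowm z n
  | m'.+1 => match n return Mor (mix W Z m'.+1 n) (tpow X n) with
             | 0 => idm 1
             | n'.+1 => u ⊠ mixm u z m' n'
             end
  end.

Fixpoint mixw W Z (w : Mor W Z) m n : Mor (mix W Z m.+1 n) (mix W Z m n) :=
  match m return Mor (mix W Z m.+1 n) (mix W Z m n) with
  | 0 => match n return Mor (mix W Z 1 n) (mix W Z 0 n) with
         | 0 => idm 1
         | n'.+1 => w ⊠ idm (tpow Z n')
         end
  | m'.+1 => match n return Mor (mix W Z m'.+2 n) (mix W Z m'.+1 n) with
             | 0 => idm 1
             | n'.+1 => idm W ⊠ mixw w m' n'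
             end
  end.

Lemma mixm_mixw W Z X (w : Mor W Z) (z : Mor Z X) m n :
  mixm (z ∘ w) z m n ∘ mixw w m n = mixm (z ∘ w) z m.+1 n.
Proof.
elim: m n => [|m IHm] [|n] /=; rewrite ?comp1m //.
  by rewrite -tensmM compm1.
by rewrite -tensmM compm1 IHm.
Qed.

(** The two objects agree for each numeral [n] but are not convertible for a variable [n], whence
    the isomorphism [h]. *)
Lemma mixm_diag W Z X (u : Mor W X) (z : Mor Z X) n :
  exists2 h : Mor (mix W Z n n) (tpow W n), is_iso h & mixm u z n n = tpowm u n ∘ h.
Proof.
elim: n => [|n [h hi E]] /=.
  by exists (idm 1); [apply: iso_id | rewrite comp1m].
exists (idm W ⊠ h); first exact: tens_iso (iso_id W) hi.
by rewrite -tensmM E compm1.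
Qed.

Fixpoint tcap Z (g : Mor Z 1) n : Mor (tpow Z n) 1 :=
  if n is n'.+1 then evl g (tcap g n') else idm 1.

Lemma tcap_epi Z (g : Mor Z 1) n : is_epi g -> is_epi (tcap g n).
Proof.
by move=> ge; elim: n => [|n IHn] /=; [apply/iso_epi/iso_id | apply: evl_epi].
Qed.

Lemma contr_tcap X Z (f : Mor X 1) (z : Mor Z X) n :
  contr f n 0 ∘ tpowm z n = tcap (f ∘ z) n.
Proof. by elim: n => [|n IHn] /=; rewrite ?comp1m // evl_tens IHn. Qed.

Section Cap.
Variables (X W Z : C) (f : Mor X 1) (u : Mor W X) (z : Mor Z X).
Hypotheses (fu : f ∘ u = 0) (fz : is_epi (f ∘ z)).

(** Since [f] kills the factors [W], the only surviving term of the sum over subsets keeps precisely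
    these and contracts every [Z]; its coefficient is 1 in any characteristic. *)
Lemma contr_mixm m n : (m <= n)%N ->
  exists2 h, is_epi h & contr f n m ∘ mixm u z m n = tpowm u m ∘ h.
Proof.
elim: m n => [|m IHm] n.
  exists (tcap (f ∘ z) n); first exact: tcap_epi.
  by rewrite /= contr_tcap comp1m.
case: n => [//|n]; rewrite ltnS => /IHm [h he E].
exists (idm W ⊠ h); first exact: tensr_epi.
by rewrite /= compDl -!tensmM evl_tens fu evl0 addr0 E comp1m compm1.
Qed.

Lemma contr_mixm0 m n : (m < n)%N -> contr f n m ∘ mixm u z m.+1 n = 0.
Proof.
elim: m n => [|m IHm] [|n] //= mn; first by rewrite evl_tens fu evl0.
by rewrite compDl evl_tens fu evl0 addr0 -tensmM (IHm n) ?tensm0.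
Qed.

End Cap.

Fixpoint mixmul W Z m n : Mor (tpow W m ⊗ tpow Z n) (mix W Z m (m + n)) :=
  match m return Mor (tpow W m ⊗ tpow Z n) (mix W Z m (m + n)) with
  | 0 => lunit (tpow Z n)
  | m'.+1 => (idm W ⊠ mixmul W Z m' n) ∘ assoc W (tpow W m') (tpow Z n)
  end.

Lemma mixmul_iso W Z m n : is_iso (mixmul W Z m n).
Proof.
elim: m => [|m IHm] /=; first exact: lunit_iso.
by apply: iso_comp (assoc_iso _ _ _); apply: tens_iso (iso_id W) IHm.
Qed.

Lemma mixm_mixmul W Z X (u : Mor W X) (z : Mor Z X) m n :
  mixm u z m (m + n) ∘ mixmul W Z m n = tmul X m n ∘ (tpowm u m ⊠ tpowm z n).
Proof.
elim: m => [|m IHm]; first by rewrite /= lunit_nat.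
rewrite [mixmul _ _ _ _]/= [tmul _ _ _]/= -!compA assoc_nat.
rewrite [mixm _ _ _ _]/= (compAE (esym (tensmM _ _ _ _))) IHm compm1.
by rewrite compA -tensmM comp1m.
Qed.

Lemma mixmul_mixw W Z (w : Mor W Z) m n :
  exists h, mixmul W Z m n.+1 ∘ (idm _ ⊠ (w ⊠ idm (tpow Z n))) = mixw w m (m + n.+1) ∘ h.
Proof.
elim: m => [|m [h IHm]].
  by exists (lunit (W ⊗ tpow Z n)); rewrite /= lunit_nat.
exists ((idm W ⊠ h) ∘ assoc _ _ _); rewrite [mixmul _ _ _ _]/= [mixw _ _ _]/=.
by rewrite -[idm (tpow W m.+1)]tensm1 -compA assoc_nat !compA -!tensmM IHm comp1m.
Qed.

Lemma adj_nat X Y (f : Mor X Y) n i : adj Y n i ∘ tpowm f n = tpowm f n ∘ adj X n i.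
Proof.
elim: n i => [|n IHn] [|i] //=; rewrite ?comp1m ?compm1 //.
  by case: n {IHn} => [|n]; [rewrite comp1m compm1 | apply: tswap_nat].
by rewrite -!tensmM IHn comp1m compm1.
Qed.

Lemma tmul_adjr X m n i :
  tmul X m n ∘ (idm _ ⊠ adj X n i) = adj X (m + n) (m + i) ∘ tmul X m n.
Proof.
elim: m => [|m IHm]; first by rewrite /= lunit_nat.
rewrite [tmul _ _ _]/= -[idm (tpow X m.+1)]tensm1 -compA assoc_nat.
by rewrite compA -tensMr IHm tensMr -compA.
Qed.

(* The symmetry in the [Z]s moves a [W] from any position to the first one. *)
Lemma tcap_desc A W Z (w : Mor W Z) (g : Mor Z 1) n T (h : Mor (A ⊗ tpow Z n) T) :
  short_exact w g -> (forall i, h ∘ (idm A ⊠ adj Z n i) = h) ->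
  match n return Mor (A ⊗ tpow Z n) T -> Prop with
  | 0 => fun=> True
  | n'.+1 => fun h => h ∘ (idm A ⊠ (w ⊠ idm (tpow Z n'))) = 0
  end h ->
  exists r, r ∘ (idm A ⊠ tcap g n) = h.
Proof.
move=> wg; have ge : is_epi g by case: wg.
elim: n h => [|n IHn] h hi.
  by move=> _; exists h; rewrite /= tensm1 compm1.
move=> hw; set Y := tpow Z n.
have [|h1 h1E] := tensr_desc (X := A) (tensl_desc (X := Y) (ses_desc wg)) (g := h).
  exact: hw.
(* As [h] vanishes on [W] in the first place and [Z/W] is the unit, [h] only sees the first factor
   through [g]; [h'] is the induced map on one factor fewer. *)
pose h' := h1 ∘ (idm A ⊠ lunitV Y).
have hE : h = h' ∘ (idm A ⊠ evl g (idm Y)).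
  rewrite /h' /evl tensMr -compA (compAE (esym (tensMr _ _ _))) lunitK tensm1.
  by rewrite comp1m h1E.
have evl1 U V (v : Mor U V) : evl g v = evl g (idm V) ∘ (idm Z ⊠ v).
  by rewrite evl_tens compm1 comp1m.
have [||r rE] := IHn h'.
- move=> i; apply: (tensr_epi (X := A) (evl_epi ge (iso_epi (iso_id Y)))) => /=.
  rewrite -hE -[in RHS](hi i.+1) hE -!compA -!tensMr comp_evl compm1.
  by rewrite [adj _ _ _]/= evl_tens compm1 comp1m.
(* [h'] must vanish on [W] in its own first place, which is the second place for [h]; the first swap
   moves this [W] to where [h] is known to vanish. *)
- case: n @Y IHn h hi hw h1 h1E @h' hE => [//|n] Y _ h hi hw h1 h1E h' hE.
  apply: (epi_eq0 (tensr_epi (X := A) (evl_epi ge (iso_epi (iso_id (W ⊗ tpow Z n)))))).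
  rewrite -compA -tensMr comp_evl compm1 evl1 tensMr compA -hE -(hi 0).
  rewrite -[adj _ _ _]/(gswap Z Z (tpow Z n)) -compA -tensMr gswap_nat tensMr compA tensm1.
  by rewrite hw comp0m.
- by exists r; rewrite hE -rE -compA -tensMr comp_evl compm1.
Qed.

End Mixed.

(** * Ranks on symmetric powers under passage from [Z] to a kernel [W] *)

Section OneStep.
Variables (k : fieldType) (C : pretannakian_category k).
Implicit Types A B D S T U W X Y Z : C.
Local Notation "1" := (tunit C) : cat_scope.

(* As [symq Z n] is epi, this is the length of the image of [Sym^n Z -> Sym^n X]. *)
Definition sym_rk X Z (z : Mor Z X) n : nat := rk (symq X n ∘ tpowm z n).

Lemma sym_rk_eq0 X Z (z : Mor Z X) n : sym_rk z n = 0%N <-> Symm z n = 0.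
Proof.
rewrite /sym_rk rk_eq0 -SymmE; split=> [|->]; last exact: comp0m.
exact: (epi_eq0 (@symq_epi _ _ _ _)).
Qed.

Lemma sym_rk_id X n : sym_rk (idm X) n = len (Sym X n).
Proof. by rewrite /sym_rk tpowm1 compm1 rk_epi //; apply: symq_epi. Qed.

Section Step.
Variables (X W Z : C) (f : Mor X 1) (z : Mor Z X) (w : Mor W Z).
Hypothesis wfz : short_exact w (f ∘ z).

Let fzw : f ∘ (z ∘ w) = 0. Proof. by rewrite compA; case: wfz. Qed.
Let fz_epi : is_epi (f ∘ z). Proof. by case: wfz. Qed.

Let J m n := symq X n ∘ mixm (z ∘ w) z m n.

Let JS m n : J m n ∘ mixw w m n = J m.+1 n.
Proof. by rewrite /J -compA mixm_mixw. Qed.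

Lemma mix_rk_ge m n : (m < n)%N -> (rk (J m.+1 n) + sym_rk (z ∘ w) m <= rk (J m n))%N.
Proof.
move=> mn; have [D DE] := sym_desc (contr_swap f n m).
have [h he E] := contr_mixm fzw fz_epi (ltnW mn).
have -> : sym_rk (z ∘ w) m = rk (D ∘ J m n).
  by rewrite /J compA DE -compA E compA rk_compr_epi.
rewrite -JS; apply: rk_chain.
by rewrite JS /J compA DE -compA (contr_mixm0 z fzw mn) compm0.
Qed.

(** Modulo the image of [J m.+1 n], the map [J m n] is symmetric in the [Z]s and vanishes once one
    of them lies in [W]. So it factors through the cap of the [Z]s, leaving a map [r] on
    [W^m ⊗ 1]. *)
Lemma mix_rk_le m n : (m < n)%N -> (rk (J m n) <= rk (J m.+1 n) + sym_rk (z ∘ w) m)%N.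
Proof.
move=> mn; have [j -> {n mn}] : exists j, n = (m + j.+1)%N.
  by exists (n - m.+1)%N; rewrite addnS -addSn subnKC.
set n := (m + j.+1)%N; rewrite (rk_coker (J m n) (mixw w m n)) JS leq_add2l.
set c := cokerm _; have cJ : c ∘ (J m n ∘ mixw w m n) = 0 by rewrite JS cokerm0.
rewrite compA in cJ.
pose h := c ∘ J m n ∘ mixmul W Z m j.+1.
have hE : h = c ∘ symq X n ∘ tmul X m j.+1 ∘ (tpowm (z ∘ w) m ⊠ tpowm z j.+1).
  by rewrite /h /J -!compA mixm_mixmul.
have [||r rE] := @tcap_desc _ _ (tpow W m) _ _ _ _ j.+1 _ h wfz.
- move=> i; rewrite hE -compA -tensmM -adj_nat compm1 -[tpowm (z ∘ w) m]comp1m tensmM.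
  have E : symq X n ∘ tmul X m j.+1 ∘ (idm _ ⊠ adj X j.+1 i) = symq X n ∘ tmul X m j.+1.
    rewrite -compA tmul_adjr compA; congr (_ ∘ _); exact: symq_swap.
  by rewrite comp1m -!(compA c) (compA _ (idm _ ⊠ _)) E.
- have [b bE] := mixmul_mixw w m j.
  by rewrite /h -compA bE compA cJ comp0m.
have te : is_epi (idm (tpow W m) ⊠ tcap (f ∘ z) j.+1).
  exact: tensr_epi (tcap_epi (n := j.+1) fz_epi).
(* The product of [W^m] with the [Z]s passes through [Sym^m X] in its first argument. Hence [r]
   kills the kernel [s] of [W^m -> Sym^m X], and its rank is at most that of this map. *)
pose s := kerm (symq X m ∘ tpowm (z ∘ w) m).
have rs : r ∘ (s ⊠ idm 1) = 0.
  apply: (epi_eq0 (tensr_epi (X := ker (symq X m ∘ tpowm (z ∘ w) m))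
    (tcap_epi (n := j.+1) fz_epi))).
  rewrite -compA -tens_lr tens_rl compA rE hE -compA -tensmM compm1.
  have [q qE] := symq_tmul X m j.+1.
  rewrite -!(compA c) -qE -!compA -tensmM comp1m (compA (symq X m)) kerm0.
  by rewrite tens0m !compm0.
have -> : rk (c ∘ J m n) = rk (r ∘ runitV (tpow W m)).
  rewrite -(rk_compr_epi _ (iso_epi (mixmul_iso W Z m j.+1))) -/h -rE.
  by rewrite rk_compr_epi // [in RHS]rk_compr_epi //; apply/iso_epi/runitV_iso.
apply: rk_ker_le; rewrite -compA runitV_nat compA rs.
exact: comp0m.
Qed.

Theorem sym_rk_step n :
  sym_rk z n = (\sum_(m < n.+1) sym_rk (z ∘ w) m)%N.
Proof.
have step m : (m <= n)%N -> rk (J 0 n) = (rk (J m n) + \sum_(i < m) sym_rk (z ∘ w) i)%N.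
  elim: m => [|m IHm] mn; first by rewrite big_ord0 addn0.
  have -> : rk (J 0 n) = _ := IHm (ltnW mn).
  have -> : rk (J m n) = (rk (J m.+1 n) + sym_rk (z ∘ w) m)%N.
    by apply/eqP; rewrite eqn_leq; apply/andP; split; [apply: mix_rk_le | apply: mix_rk_ge].
  by rewrite big_ord_recr /= -addnA (addnC (sym_rk _ _)).
(* The chain stops at [J n n], which is not zero in general: its rank is the summand [m = n]. *)
rewrite -[LHS]/(rk (J 0 n)) (step n) // big_ord_recr /= addnC; congr (_ + _)%N.
have [h hi E] := mixm_diag (z ∘ w) z n.
by rewrite /J E compA rk_compr_epi //; apply: iso_epi.
Qed.

End Step.

Lemma sym_rk0 X Z (z : Mor Z X) : (0 < sym_rk z 0)%N.
Proof.
rewrite lt0n; apply/eqP => /rk_eq0; rewrite compm1 => q0.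
have [|h hE] := sym_desc (X := X) (n := 0) (g := idm 1); first by move=> i; rewrite comp1m.
by apply: (@unit_nonzero _ C); rewrite /is_zero -hE q0 compm0.
Qed.

(** The projection from the tensor power of order [n + 1] factors through [X ⊗ Sym^n X]. *)
Lemma sym_rk_eq0S X Z (z : Mor Z X) n : sym_rk z n = 0%N -> sym_rk z n.+1 = 0%N.
Proof.
move/rk_eq0 => z0; apply/rk_eq0; have [h <-] := symq_mul X n.
by rewrite -compA -tensmM comp1m z0 tensm0 compm0.
Qed.

Lemma sym_rk_factor X Y Z (y : Mor Y X) (z : Mor Z Y) n :
  (sym_rk (y ∘ z) n <= sym_rk y n)%N.
Proof. by rewrite /sym_rk tpowmM compA rk_comp_r. Qed.

Lemma len_Sym_le X n : len (Sym_le X n) = (\sum_(m < n.+1) len (Sym X m))%N.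
Proof. by rewrite /Sym_le len_dsum -[iota 0 n.+1]/(index_iota 0 n.+1) big_mkord. Qed.

End OneStep.

(** * Flags of kernels *)

Definition cumul (a : nat -> nat) n : nat := (\sum_(m < n.+1) a m)%N.

Section Span.
Variables (k : fieldType) (V : lmodType k).
Implicit Types (s : seq V) (f g : V).

(** Coefficients are indexed by [nat], so that adding a head to [s] shifts them without changing
    their type. *)
Definition in_span s g : Prop := exists c : nat -> k, g = \sum_(i < size s) c i *: s`_i.

Lemma in_span_nil g : in_span [::] g <-> g = 0.
Proof.
split=> [[c ->] | ->]; first by rewrite big_ord0.
by exists (fun=> 0); rewrite big_ord0.
Qed.

Lemma in_span_cons f s g : in_span (f :: s) g <-> exists a, in_span s (g - a *: f).
Proof.
split=> [[c ->] | [a [c E]]].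
  by exists (c 0%N); exists (fun i => c i.+1); rewrite big_ord_recl /= addrC addKr.
exists (fun i => if i is i'.+1 then c i' else a).
by rewrite big_ord_recl /= -E addrC subrK.
Qed.

Lemma lin_indep_head n (e : 'I_n.+1 -> V) : lin_indep e ->
  lin_indep (e \o lift ord0) /\
  ~ in_span [seq e (lift ord0 i) | i <- enum 'I_n] (e ord0).
Proof.
move=> ei; split=> [c c0 i | [c]].
  have := ei (fun j => if unlift ord0 j is Some j' then c j' else 0).
  rewrite big_ord_recl unlift_none scale0r add0r.
  under eq_bigr => j _ do rewrite liftK.
  by move/(_ c0 (lift ord0 i)); rewrite liftK.
rewrite size_map size_enum_ord => E.
have := ei (fun j => if unlift ord0 j is Some j' then c j' else -1).
rewrite big_ord_recl unlift_none scaleN1r E.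
under eq_bigr => j _ do
  rewrite (nth_map j) ?size_enum_ord // nth_ord_enum.
under [X in _ + X]eq_bigr => j _ do rewrite liftK.
rewrite addNr => /(_ erefl ord0)/eqP.
by rewrite unlift_none oppr_eq0 oner_eq0.
Qed.

End Span.

Section Flags.
Variables (k : fieldType) (C : pretannakian_category k).
Implicit Types A B D S T U W X Y Z : C.
Local Notation "1" := (tunit C) : cat_scope.

(* [z] is the common kernel of the maps in [s], built one map at a time. *)
Inductive flag X : forall Z, Mor Z X -> seq (Mor X 1) -> Prop :=
| flag_nil : flag (idm X) [::]
| flag_cons Z W (z : Mor Z X) (w : Mor W Z) f s :
    flag z s -> short_exact w (f ∘ z) -> flag (z ∘ w) (f :: s).

Definition complete X Z (z : Mor Z X) : Prop := forall g : Mor X 1, g ∘ z = 0.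

Lemma flag_kills X Z (z : Mor Z X) s f : flag z s -> f \in s -> f ∘ z = 0.
Proof.
elim=> [//|{}Z W {}z w g {}s _ IH [_ _ wg _]]; rewrite inE => /orP[/eqP->|/IH fz].
  by rewrite compA wg.
by rewrite compA fz comp0m.
Qed.

Lemma flag_lift X Z (z : Mor Z X) s T (x : Mor T X) :
  flag z s -> (forall f, f \in s -> f ∘ x = 0) -> exists y, z ∘ y = x.
Proof.
elim=> [_|{}Z W {}z w g {}s _ IH [_ _ _ lift] H]; first by exists x; rewrite comp1m.
have [|y zy] := IH; first by move=> f fs; apply: H; rewrite inE fs orbT.
have [|v wv] := lift _ y; first by rewrite -compA zy H ?mem_head.
by exists v; rewrite -compA wv.
Qed.

(** At each step [g ∘ z] kills [w], so it factors through [f ∘ z] by an endomorphism of the unit,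
    that is, a scalar [a]; then [g - a *: f] vanishes one stage earlier. *)
Lemma flag_span X Z (z : Mor Z X) s g : flag z s -> g ∘ z = 0 -> in_span s g.
Proof.
move=> zs; elim: zs g => [g|{}Z W {}z w f {}s _ IH wf g gzw].
  by rewrite compm1 => ->; apply/in_span_nil.
have [|h hE] := ses_desc wf (g := g ∘ z); first by rewrite -compA.
have [a aE] := unit_scalar h; apply/in_span_cons; exists a; apply: IH.
by rewrite compBl -hE aE !compZl comp1m subrr.
Qed.

Lemma flag_len X Z (z : Mor Z X) s : flag z s -> len X = (len Z + size s)%N.
Proof.
elim=> [|{}Z W {}z w f {}s _ IH wf]; first by rewrite addn0.
by rewrite IH (len_ses wf) len_unit /= addn1 addSnnS.
Qed.

(** Restricted to the stage [z] before [f] was added, a relation retains only its [f]-term, and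
    [f ∘ z] is nonzero. *)
Lemma flag_lin_indep X Z (z : Mor Z X) s :
  flag z s -> lin_indep (fun i : 'I_(size s) => s`_i).
Proof.
elim=> [c _ [] //|{}Z W {}z w f {}s zs IH [_ fe _ _] c].
rewrite big_ord_recl /= => E.
have c0 : c ord0 = 0.
  have := congr1 (fun h => h ∘ z) E; rewrite compDl comp0m comp_suml big1 => [|i _].
    rewrite addr0 compZl => /eqP; rewrite scaler_eq0 => /orP[/eqP //|/eqP fz0].
    by case: (epi_to_unit_neq0 fe fz0).
  rewrite compZl (flag_kills zs) ?scaler0 //; exact: (mem_nth 0 (ltn_ord i)).
move: E; rewrite c0 scale0r add0r => /IH H i.
by case: (unliftP (ord0 : 'I_(size s).+1) i) => [j ->|->]; [apply: H | apply: c0].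
Qed.

Lemma flag_extend X Z (z : Mor Z X) s f :
  flag z s -> f ∘ z <> 0 -> exists W (w : Mor W Z), flag (z ∘ w) (f :: s).
Proof.
move=> zs /nonzero_to_unit fe; exists (ker (f ∘ z)), (kerm (f ∘ z)).
by apply: flag_cons => //; apply: ker_ses.
Qed.

Lemma lin_indep_flag X n (e : 'I_n -> Mor X 1) : lin_indep e ->
  exists Z (z : Mor Z X), flag z [seq e i | i <- enum 'I_n].
Proof.
elim: n e => [|n IHn] e ei.
  by exists X, (idm X); rewrite enum_ord0; apply: flag_nil.
have [ei' e0] := lin_indep_head ei.
have [Z [z zs]] := IHn _ ei'.
have [|W [w zw]] := flag_extend (f := e ord0) zs.
  by move=> ez; apply: e0; apply: flag_span zs ez.
exists W, (z ∘ w); rewrite enum_ordSl /= -map_comp.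
exact: zw.
Qed.

(** Every extension lowers the length of the kernel by one, so the process stops. This is where
    finite dimension of [Hom(X, 1)] comes from. *)
Lemma complete_flag X : exists Z (z : Mor Z X) s, flag z s /\ complete z.
Proof.
suff H n Z (z : Mor Z X) s : flag z s -> (len Z <= n)%N ->
    exists Z' (z' : Mor Z' X) s', flag z' s' /\ complete z'.
  exact: (H (len X) X (idm X) [::] (flag_nil X) (leqnn _)).
elim: n Z z s => [|n IHn] Z z s zs Zn.
  exists Z, z, s; split=> // g; apply: zero_mor_from.
  by apply/len_eq0/eqP; rewrite -leqn0.
have [zc | /existsNP[g gz]] := pselect (complete z); first by exists Z, z, s.
have [W [w zw]] := flag_extend zs gz; apply: (IHn _ _ _ zw).
have := flag_len zw; rewrite (flag_len zs) /= -addSnnS => /eqP.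
by rewrite eqn_add2r => /eqP E; rewrite -ltnS -E.
Qed.

(** The kernel of a complete flag embeds into the kernel built from [e], and the two lengths are
    [len X] minus the numbers of maps. *)
Lemma complete_flag_size X Z (z : Mor Z X) s n (e : 'I_n -> Mor X 1) :
  flag z s -> complete z -> lin_indep e -> (n <= size s)%N.
Proof.
move=> zs zc /lin_indep_flag[Z' [z' zs']].
have [|y yE] := flag_lift (x := z) zs'; first by move=> f _; apply: zc.
have zm : is_mono z.
  by elim: zs {zc y yE} => [|{}Z W {}z w f {}s _ IH [wm _ _ _]];
    [apply/iso_mono/iso_id | apply: mono_comp].
have ym : is_mono y by apply: (@mono_compr _ _ _ _ _ z'); rewrite yE.
have := flag_len zs'; rewrite (flag_len zs) size_map size_enum_ord => E.
by rewrite -(leq_add2l (len Z)) E leq_add2r (len_mono ym).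
Qed.

Lemma complete_dimk (R : realType) X Z (z : Mor Z X) s :
  flag z s -> complete z -> dimk (Mor X 1) R = ((size s)%:R)%:E.
Proof.
move=> zs zc; apply/eqP; rewrite eq_le; apply/andP; split.
  apply: ge_ereal_sup => _ [n [e ei] <-]; rewrite lee_fin ler_nat.
  exact: complete_flag_size zs zc ei.
apply: ereal_sup_ubound; exists (size s) => //.
by exists (fun i : 'I_(size s) => s`_i); apply: flag_lin_indep zs.
Qed.

Lemma flag_len_Sym X Z (z : Mor Z X) s n :
  flag z s -> len (Sym_le X n) = iter (size s).+1 cumul (sym_rk z) n.
Proof.
move=> zs; rewrite len_Sym_le iterS; apply: eq_bigr => m _; rewrite -sym_rk_id.
elim: zs (nat_of_ord m) => [//|{}Z W {}z w f {}s _ IH wf] {}m.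
rewrite IH [size _]/= iterSr; congr (iter _ _ _ _); apply: funext => i.
exact: sym_rk_step wf i.
Qed.

Lemma dsum_pair_eq0 (I : eqType) Z (F : I -> C) (f : forall i, Mor Z (F i)) s T
    (x : Mor T Z) :
  dsum_pair f s ∘ x = 0 <-> (forall i, i \in s -> f i ∘ x = 0).
Proof.
elim: s => [|i s IHs] /=; first by rewrite comp0m.
split=> [E j | H]; last first.
  rewrite compDl -!compA H ?mem_head // compm0 add0r (IHs.2 _) ?compm0 // => j js.
  by apply: H; rewrite inE js orbT.
rewrite inE => /orP[/eqP-> | js].
  have := congr1 (fun h => prl_ _ _ ∘ h) E.
  by rewrite compm0 compDl compDr !compA prl_inl prl_inr !comp0m addr0 comp1m.
apply: IHs.1 js; have := congr1 (fun h => prr_ _ _ ∘ h) E.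
by rewrite compm0 compDl compDr !compA prr_inl prr_inr !comp0m add0r comp1m.
Qed.

Lemma tilde_factor X n (e : 'I_n -> Mor X 1) T (x : Mor T X) :
  (forall i, e i ∘ x = 0) <-> exists y, tilde_incl e ∘ y = x.
Proof.
split=> [ex | [y <-] i].
  have x0 : triv_quot e ∘ x = 0 by apply/dsum_pair_eq0 => i _.
  by exists (ker_lift x0); apply: ker_liftE.
have /dsum_pair_eq0 H : triv_quot e ∘ tilde_incl e = 0 := kerm0 _.
by rewrite compA H ?mem_enum ?comp0m.
Qed.

(** The iterated kernel [z] and [tilde_incl e] factor through each other, which already forces equal
    ranks on all symmetric powers. *)
Lemma flag_tilde X n (e : 'I_n -> Mor X 1) : is_basis e ->
  exists Z (z : Mor Z X), [/\ flag z [seq e i | i <- enum 'I_n], complete z &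
    forall m, sym_rk z m = sym_rk (tilde_incl e) m].
Proof.
move=> [ei espan]; have [Z [z zs]] := lin_indep_flag ei; exists Z, z.
have ez i : e i ∘ z = 0 by apply: flag_kills zs _; rewrite map_f ?mem_enum.
split=> // [g | m].
  have [c ->] := espan g; rewrite comp_suml big1 // => i _.
  by rewrite compZl ez scaler0.
apply/eqP; rewrite eqn_leq; apply/andP; split.
  by have [y <-] := (tilde_factor e z).1 ez; apply: sym_rk_factor.
have [|y <-] := flag_lift (x := tilde_incl e) zs; last exact: sym_rk_factor.
move=> f /mapP[i _ ->]; apply: (tilde_factor e _).2.
by exists (idm _); rewrite compm1.
Qed.

Lemma complete_basis X Z (z : Mor Z X) s :
  flag z s -> complete z -> is_basis (fun i : 'I_(size s) => s`_i).
Proof.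
move=> zs zc; split; first exact: flag_lin_indep zs.
by move=> g; have [c ->] := flag_span zs (zc g); exists (fun i => c i).
Qed.

End Flags.

(** * Growth *)

Section Cumul.
Implicit Types (a b : nat -> nat) (j n : nat).

Lemma leq_cumul a b n : (forall m, a m <= b m)%N -> (cumul a n <= cumul b n)%N.
Proof. by move=> ab; apply: leq_sum. Qed.

Lemma leq_iter_cumul a b j n :
  (forall m, a m <= b m)%N -> (iter j cumul a n <= iter j cumul b n)%N.
Proof. by move=> ab; elim: j n => [//|j IHj] n; apply: leq_cumul. Qed.

(** The hockey-stick identity, iterated. *)
Lemma iter_cumul_const c j n : iter j cumul (fun=> c) n = (c * 'C(n + j, j))%N.
Proof.
elim: j n => [|j IHj] n; first by rewrite bin0 muln1.
rewrite iterS /cumul; under eq_bigr do rewrite IHj.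
rewrite -big_distrr /=; congr (c * _)%N.
elim: n => [|n IHn]; first by rewrite big_ord1 !add0n !binn.
by rewrite big_ord_recr /= IHn [in RHS]addSn binS addSnnS.
Qed.

Lemma exp_le_bin j n : (n ^ j <= j`! * 'C(n + j, j))%N.
Proof.
rewrite mulnC bin_ffact; elim: j => [//|j IHj].
by rewrite addnS ffactSS expnS leq_mul // -addnS leq_addr.
Qed.

Lemma bin_le_exp j n : ('C(n + j, j) <= n.+1 ^ j)%N.
Proof.
elim: j => [|j IHj]; first by rewrite bin0.
rewrite -(leq_pmul2l (ltn0Sn j)) addnS -mul_bin_diag expnS mulnA leq_mul //.
by rewrite mulSn -addSn leq_add2l leq_pmulr.
Qed.

End Cumul.

Section Growth.
Variable R : realType.
Implicit Types (L : nat -> nat) (d n : nat).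

Let rate L n : \bar R := (ln (L n)%:R / ln n%:R)%:E.

(** Lets an error [e] in the rate absorb the logarithm [K] of a multiplicative constant, and makes
    division by [ln n] legitimate. *)
Lemma eventually_ln (K e : R) : 0 < e ->
  exists N, forall n, (N <= n)%N -> 0 < ln (n%:R : R) /\ K <= e * ln (n%:R : R).
Proof.
move=> e0; pose x := Num.max 1 (K / e).
have [N xN] : exists N, expR x <= N%:R :> R.
  by exists (Num.bound (expR x)); apply/ltW/archi_boundP/expR_ge0.
exists N => n Nn; have xn : expR x <= n%:R :> R by rewrite (le_trans xN) // ler_nat.
have n0 : 0 < n%:R :> R by apply: lt_le_trans xn; apply: expR_gt0.
have xln : x <= ln (n%:R : R) by rewrite -ler_expR lnK ?posrE.
split; first by apply: lt_le_trans xln; rewrite lt_max ltr01.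
by rewrite mulrC -ler_pdivrMr // (le_trans _ xln) // le_max lexx orbT.
Qed.

Lemma limn_esup_rate_ge L d c : (forall n, n ^ d <= c * L n)%N ->
  ((d%:R)%:E <= limn_esup (rate L))%E.
Proof.
move=> H; apply/lee_subgt0Pr => e e0.
rewrite /limn_esup limf_esupE; apply: le_ereal_inf_tmp => _ [V [M _ MV] <-].
have [N NP] := eventually_ln (ln (c%:R : R)) e0; set n := maxn M N.
have [ln0 cln] := NP n (leq_maxr _ _).
apply: (@le_trans _ _ (rate L n)); last first.
  by apply: ereal_sup_ubound; exists n => //; apply: MV; rewrite /= leq_maxl.
rewrite lee_fin ler_pdivlMr // mulrBl.
have n0 : (0 < n)%N by rewrite lt0n; apply: contraTneq ln0 => ->; rewrite ln0 ?ltxx.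
have : (0 < c * L n)%N by apply: leq_trans (H n); rewrite expn_gt0 n0.
rewrite muln_gt0 => /andP[c0 L0].
rewrite lerBlDr mulr_natl -lnXn ?ltr0n // -natrX.
have : ln ((n ^ d)%:R : R) <= ln (c%:R : R) + ln (L n)%:R.
  by rewrite -lnM ?posrE ?ltr0n // -natrM ler_ln ?posrE ?ltr0n ?muln_gt0 ?c0 //
    ?ler_nat ?H // expn_gt0 n0.
by move/le_trans; apply; rewrite addrC lerD2l.
Qed.

Lemma limn_esup_rate_le L d B : (forall n, 0 < L n <= B * n.+1 ^ d)%N ->
  (limn_esup (rate L) <= (d%:R)%:E)%E.
Proof.
move=> H; apply/lee_addgt0Pr => e e0.
(* The factor [2 ^+ d] comes from [(n + 1)^d <= (2 n)^d] for positive [n]. *)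
pose K : R := ln (B%:R * 2 ^+ d).
have [N NP] := eventually_ln K e0.
rewrite /limn_esup limf_esupE.
apply: (@le_trans _ _ (ereal_sup (rate L @` [set n | (N <= n)%N])%classic)).
  by apply: ereal_inf_lbound; exists [set n | (N <= n)%N]%classic => //; exists N.
apply: ge_ereal_sup => _ [n Nn <-]; have [ln0 Kln] := NP n Nn.
rewrite lee_fin ler_pdivrMr // mulrDl.
have n0 : (0 < n)%N by rewrite lt0n; apply: contraTneq ln0 => ->; rewrite ln0 ?ltxx.
have /andP[L0 LB] := H n.
have B0 : (0 < B)%N by move: (leq_trans L0 LB); rewrite muln_gt0 => /andP[].
apply: (@le_trans _ _ (K + d%:R * ln n%:R)); last by rewrite addrC lerD2l.
rewrite /K [d%:R * _]mulr_natl -lnXn ?ltr0n // -lnM ?posrE ?mulr_gt0 ?exprn_gt0 ?ltr0n //.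
rewrite ler_ln ?posrE ?mulr_gt0 ?exprn_gt0 ?ltr0n //.
rewrite -mulrA -exprMn -natrM -natrX -natrM ler_nat (leq_trans LB) //.
rewrite leq_mul //; case: (d) => [|d']; first by rewrite !expn0.
by rewrite leq_exp2r // mul2n -addnn -addn1 leq_add2l.
Qed.

End Growth.

(** * Growth dimension in terms of a flag *)

Section SymmetricGrowth.
Variables (R : realType) (k : fieldType) (C : pretannakian_category k).
Variables (X Z : C) (z : Mor Z X) (s : seq (Mor X (tunit C))).
Hypothesis zs : flag z s.

(** The rank at 0 is positive, so one of the [(size s).+1] summations already gives a sequence
    bounded below by 1; the other [size s] produce the binomial coefficient. *)
Let len_ge c n : (c <= 'C(n + size s, size s))%N -> (c <= len (Sym_le X n))%N.
Proof.
move/leq_trans; apply; rewrite (flag_len_Sym _ zs) iterSr.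
rewrite -['C(_, _)]mul1n -iter_cumul_const; apply: leq_iter_cumul => m.
by rewrite /cumul big_ord_recl (leq_trans (sym_rk0 z)) // leq_addr.
Qed.

Lemma sgd_ge : (((size s)%:R)%:E <= sgd R X)%E.
Proof.
apply: (@limn_esup_rate_ge _ _ _ (size s)`!) => n.
by apply: leq_trans (exp_le_bin _ _) _; rewrite leq_mul2l len_ge ?orbT.
Qed.

Lemma sgd_gt : (forall n, sym_rk z n <> 0%N) -> (((size s)%:R)%:E < sgd R X)%E.
Proof.
move=> z0; apply: (@lt_le_trans _ _ (((size s).+1%:R)%:E)).
  by rewrite lte_fin ltr_nat.
apply: (@limn_esup_rate_ge _ _ _ (size s).+1`!) => n.
apply: leq_trans (exp_le_bin _ _) _; rewrite leq_mul2l; apply/orP; right.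
rewrite (flag_len_Sym _ zs) -['C(_, _)]mul1n -iter_cumul_const.
by apply: leq_iter_cumul => m; rewrite lt0n; apply/eqP.
Qed.

Lemma sgd_le N : sym_rk z N = 0%N -> (sgd R X <= ((size s)%:R)%:E)%E.
Proof.
move=> zN; have z0 n : (N <= n)%N -> sym_rk z n = 0%N.
  elim: n => [|n IHn]; first by rewrite leqn0 => /eqP N0; rewrite -[in LHS]N0.
  by rewrite leq_eqVlt => /orP[/eqP <- //|/IHn]; apply: sym_rk_eq0S.
apply: (@limn_esup_rate_le _ _ _ (cumul (sym_rk z) N)) => n.
rewrite len_ge /=; last by rewrite bin_gt0 leq_addl.
rewrite (flag_len_Sym _ zs) iterSr.
(* As the ranks vanish from [N] on, the innermost partial sums never exceed their value at [N],
   leaving [size s] summations of a constant. *)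
apply: (@leq_trans (iter (size s) cumul (fun=> cumul (sym_rk z) N) n)); last first.
  by rewrite iter_cumul_const leq_mul // bin_le_exp.
apply: leq_iter_cumul => m.
have [mN | Nm] := leqP m N; rewrite /cumul.
  have -> : N.+1 = (m.+1 + (N - m))%N by rewrite addSn subnKC.
  by rewrite big_split_ord leq_addr.
have -> : m.+1 = (N.+1 + (m - N))%N by rewrite addSn subnKC // ltnW.
rewrite big_split_ord /= [X in (_ + X)%N]big1 ?addn0 // => i _.
by apply: z0; rewrite addSn -addnS leq_addr.
Qed.

Lemma sgd_eqP : ((size s)%:R)%:E = sgd R X <-> exists N, sym_rk z N = 0%N.
Proof.
split=> [E | [N zN]]; last by apply/eqP; rewrite eq_le sgd_ge (sgd_le zN).
by apply: contrapT => /forallNP /sgd_gt; rewrite -E ltxx.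
Qed.

End SymmetricGrowth.

(** * Direct sums in the ind-completion *)

Section Coproduct.
Variables (k : fieldType) (C : abelian_category k) (F : nat -> C).
Implicit Types (A B D : C) (P Q S : ind_object C).

(** The value at [A] of the direct sum of the [F n] in the ind-completion: a map from an object of
    [C] meets finitely many summands only. *)
Record fsum (A : C) := FSum {
  fsum_val :> forall n, Mor A (F n);
  fsum_fin : exists N, forall n, (N <= n)%N -> fsum_val n = 0 }.

Section Lmodule.
Variable A : C.

Lemma fsum_ext (x y : fsum A) : (forall n, x n = y n) -> x = y.
Proof.
case: x y => [x xf] [y yf] /= xy.
have E : x = y by apply: functional_extensionality_dep.
by case: _ / E yf => yf; congr FSum; apply: Prop_irrelevance.
Qed.

Lemma fsum_add_fin (x y : fsum A) : exists N, forall n, (N <= n)%N -> x n + y n = 0.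
Proof.
have [[M xM] [N yN]] := (fsum_fin x, fsum_fin y); exists (maxn M N) => n.
by rewrite geq_max => /andP[/xM -> /yN ->]; rewrite addr0.
Qed.

Lemma fsum_opp_fin (x : fsum A) : exists N, forall n, (N <= n)%N -> - x n = 0.
Proof. by have [M xM] := fsum_fin x; exists M => n /xM ->; rewrite oppr0. Qed.

Lemma fsum_scale_fin (a : k) (x : fsum A) :
  exists N, forall n, (N <= n)%N -> a *: x n = 0.
Proof. by have [M xM] := fsum_fin x; exists M => n /xM ->; rewrite scaler0. Qed.

Lemma fsum_zero_fin : exists N, forall n, (N <= n)%N -> (0 : Mor A (F n)) = 0.
Proof. by exists 0%N. Qed.

Definition fsum_zero : fsum A := FSum fsum_zero_fin.
Definition fsum_add x y : fsum A := FSum (fsum_add_fin x y).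
Definition fsum_opp x : fsum A := FSum (fsum_opp_fin x).
Definition fsum_scale a x : fsum A := FSum (fsum_scale_fin a x).

HB.instance Definition _ := gen_eqMixin (fsum A).
HB.instance Definition _ := gen_choiceMixin (fsum A).

Lemma fsum_addA : associative fsum_add.
Proof. by move=> x y z; apply: fsum_ext => n; apply: addrA. Qed.
Lemma fsum_addC : commutative fsum_add.
Proof. by move=> x y; apply: fsum_ext => n; apply: addrC. Qed.
Lemma fsum_add0 : left_id fsum_zero fsum_add.
Proof. by move=> x; apply: fsum_ext => n; apply: add0r. Qed.
Lemma fsum_addN : left_inverse fsum_zero fsum_opp fsum_add.
Proof. by move=> x; apply: fsum_ext => n; apply: addNr. Qed.

HB.instance Definition _ :=
  GRing.isZmodule.Build (fsum A) fsum_addA fsum_addC fsum_add0 fsum_addN.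

Lemma fsum_scaleA a b x : fsum_scale a (fsum_scale b x) = fsum_scale (a * b) x.
Proof. by apply: fsum_ext => n; apply: scalerA. Qed.
Lemma fsum_scale1 : left_id 1 fsum_scale.
Proof. by move=> x; apply: fsum_ext => n; apply: scale1r. Qed.
Lemma fsum_scaleDr : right_distributive fsum_scale +%R.
Proof. by move=> a x y; apply: fsum_ext => n; apply: scalerDr. Qed.
Lemma fsum_scaleDl x : {morph fsum_scale^~ x : a b / a + b}.
Proof. by move=> a b; apply: fsum_ext => n; apply: scalerDl. Qed.

HB.instance Definition _ := GRing.Zmodule_isLmodule.Build k (fsum A)
  fsum_scaleA fsum_scale1 fsum_scaleDr fsum_scaleDl.

End Lmodule.

Lemma fsum_res_fin A B (f : Mor A B) (x : fsum B) :
  exists N, forall n, (N <= n)%N -> x n ∘ f = 0.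
Proof. by have [M xM] := fsum_fin x; exists M => n /xM ->; rewrite comp0m. Qed.

Definition fsum_res A B (f : Mor A B) (x : fsum B) : fsum A := FSum (fsum_res_fin f x).

Lemma fsum_res1 A (x : fsum A) : fsum_res (idm A) x = x.
Proof. by apply: fsum_ext => n; apply: compm1. Qed.

Lemma fsum_resM A B D (g : Mor B D) (f : Mor A B) x :
  fsum_res (g ∘ f) x = fsum_res f (fsum_res g x).
Proof. by apply: fsum_ext => n; apply: compA. Qed.

Lemma fsum_res_linear A B (f : Mor A B) : linear (fsum_res f).
Proof. by move=> a x y; apply: fsum_ext => n; rewrite /= compDl compZl. Qed.

Lemma fsum_res_linear_hom A B (x : fsum B) : linear (fun f : Mor A B => fsum_res f x).
Proof. by move=> a f g; apply: fsum_ext => n; rewrite /= compDr compZr. Qed.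

Lemma fsum_lex_inj A B (f : Mor A B) : injective (fsum_res (cokerm f)).
Proof.
move=> x y xy; apply: fsum_ext => n; apply: (cokerm_epi (f := f)).
exact: (congr1 (fun h : fsum B => h n) xy).
Qed.

Lemma fsum_lex_exact A B (f : Mor A B) (x : fsum B) :
  fsum_res f x = 0 -> exists y, fsum_res (cokerm f) y = x.
Proof.
move=> xf; have xf0 n : x n ∘ f = 0 := congr1 (fun h : fsum A => h n) xf.
(* The componentwise descents still have finite support, because [cokerm f] is epi and so a zero
   component descends to zero. *)
have y_fin : exists N, forall n, (N <= n)%N -> coker_desc (xf0 n) = 0.
  have [N xN] := fsum_fin x; exists N => n /xN x0.
  by apply: (epi_eq0 (cokerm_epi (f := f))); rewrite coker_descE.
by exists (FSum y_fin); apply: fsum_ext => n; apply: coker_descE.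
Qed.

Definition ind_sum : ind_object C :=
  @IndObject _ C (fun A => fsum A) fsum_res fsum_res1 fsum_resM fsum_res_linear
    fsum_res_linear_hom fsum_lex_inj fsum_lex_exact.

Section Inj.
Variable n : nat.

Definition single A (x : Mor A (F n)) m : Mor A (F m) :=
  dfwith (fun m => 0 : Mor A (F m)) x m.

Lemma single_diag A (x : Mor A (F n)) : single x n = x.
Proof. exact: dfwith_in. Qed.

Lemma single_off A (x : Mor A (F n)) m : n != m -> single x m = 0.
Proof. by move=> nm; apply: dfwith_out. Qed.

Lemma single_fin A (x : Mor A (F n)) :
  exists N, forall m, (N <= m)%N -> single x m = 0.
Proof. by exists n.+1 => m nm; rewrite single_off // ltn_eqF. Qed.

Definition ind_inj_fun A (x : yo (F n) A) : ind_sum A := FSum (single_fin x).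

Lemma ind_inj_linear A : linear (@ind_inj_fun A).
Proof.
move=> a x y; apply: fsum_ext => m /=; have [<- | nm] := eqVneq n m.
  by rewrite !single_diag.
by rewrite !single_off // scaler0 addr0.
Qed.

Lemma ind_inj_nat A B (f : Mor A B) x :
  ind_inj_fun (ind_res (yo (F n)) f x) = ind_res ind_sum f (ind_inj_fun x).
Proof.
apply: fsum_ext => m /=; have [<- | nm] := eqVneq n m.
  by rewrite !single_diag.
by rewrite !single_off // comp0m.
Qed.

Definition ind_inj : ind_hom (yo (F n)) ind_sum := IndHom ind_inj_linear ind_inj_nat.

End Inj.

Lemma ind_hom_sum P Q (u : ind_hom P Q) A N (x : 'I_N -> P A) :
  u A (\sum_i x i) = \sum_i u A (x i).
Proof.
have u0 : u A 0 = 0.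
  by have := ind_app_linear u (-1) (0 : P A) 0; rewrite scaler0 addr0 scaleN1r addNr.
elim/big_rec2: _ => [//|i y y' _ <-].
by have := ind_app_linear u 1 (x i) y'; rewrite !scale1r.
Qed.

Lemma ind_hom0 P Q (u : ind_hom P Q) A : u A 0 = 0.
Proof. by have := @ind_hom_sum P Q u A 0 (fun=> 0); rewrite !big_ord0. Qed.

Lemma fsum_val_sum A N (x : 'I_N -> ind_sum A) n :
  fsum_val (\sum_i x i) n = \sum_i fsum_val (x i) n.
Proof. by elim/big_rec2: _ => [//|i y y' _ <-]. Qed.

Lemma fsum_decomp A (x : ind_sum A) N : (forall n, (N <= n)%N -> fsum_val x n = 0) ->
  x = \sum_(i < N) ind_inj i A (fsum_val x i).
Proof.
move=> xN; apply: fsum_ext => n; rewrite fsum_val_sum /=.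
have [nN | Nn] := ltnP n N.
  rewrite (bigD1 (Ordinal nN)) //= single_diag big1 ?addr0 // => i ni.
  by rewrite single_off.
rewrite xN // big1 // => i _; rewrite single_off // ltn_eqF //.
exact: leq_trans (ltn_ord i) Nn.
Qed.

Lemma ind_sum_coproduct : is_ind_coproduct ind_inj.
Proof.
move=> Q u.
pose w A (x : ind_sum A) : Q A := \sum_(i < sval (cid (fsum_fin x))) u i A (fsum_val x i).
(* The sum defining [w] runs up to a chosen bound of the support; any other bound gives the same
   value, so [x] and [y] can share one in the proof of linearity. *)
have wE A (x : ind_sum A) N : (forall n, (N <= n)%N -> fsum_val x n = 0) ->
    w A x = \sum_(i < N) u i A (fsum_val x i).
  have ext M M' : (forall n, (M <= n)%N -> fsum_val x n = 0) -> (M <= M')%N ->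
      \sum_(i < M') u i A (fsum_val x i) = \sum_(i < M) u i A (fsum_val x i).
    move=> xM /subnKC <-; rewrite big_split_ord /= [X in _ + X]big1 ?addr0 // => i _.
    by rewrite xM ?leq_addr ?ind_hom0.
  rewrite /w; case: cid => M /= xM xN.
  by rewrite -(ext M (maxn M N)) ?leq_maxl // -(ext N (maxn M N)) ?leq_maxr.
have w_lin A : linear (w A).
  move=> a x y; have [[M xM] [N yN]] := (fsum_fin x, fsum_fin y).
  have xM' n : (maxn M N <= n)%N -> fsum_val x n = 0.
    by rewrite geq_max => /andP[/xM].
  have yN' n : (maxn M N <= n)%N -> fsum_val y n = 0.
    by rewrite geq_max => /andP[_ /yN].
  rewrite (wE _ x _ xM') (wE _ y _ yN') (wE _ _ (maxn M N)); last first.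
    by move=> n nM; rewrite /= xM' // yN' // scaler0 addr0.
  by rewrite scaler_sumr -big_split; apply: eq_bigr => i _; apply: ind_app_linear.
have w_nat A B (f : Mor A B) x : w A (ind_res ind_sum f x) = ind_res Q f (w B x).
  have [M xM] := fsum_fin x; rewrite (wE _ x _ xM) (wE _ _ M); last first.
    by move=> n /xM x0; rewrite /= x0 comp0m.
  have res0 : ind_res Q f 0 = 0.
    by have := ind_res_linear (i := Q) f (-1) 0 0; rewrite scaler0 addr0 scaleN1r addNr.
  have resD y y' : ind_res Q f (y + y') = ind_res Q f y + ind_res Q f y'.
    by have := ind_res_linear (i := Q) f 1 y y'; rewrite !scale1r.
  elim/big_rec2: _ => [//|i y y' _ ->]; rewrite resD; congr (_ + _).
  exact: (ind_app_nat (u i) f).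
exists (IndHom w_lin w_nat); split=> [n A x | w' w'E A x].
  rewrite /= (wE _ _ n.+1) => [|m nm]; last by rewrite /= single_off // ltn_eqF.
  rewrite big_ord_recr /= single_diag big1 ?add0r // => i _.
  by rewrite single_off ?ind_hom0 // gtn_eqF.
have [N xN] := fsum_fin x; rewrite /= (wE _ _ _ xN) {1}(fsum_decomp xN) ind_hom_sum.
by apply: eq_bigr => i _; apply: w'E.
Qed.

End Coproduct.

(** The maps are given for every [n] and vanish from [N] on, to be composed with families indexed by
    [nat] without ordinals. *)
Lemma finite_biproduct (k : fieldType) (C : abelian_category k) (G : nat -> C) N :
  exists (B : C) (i : forall n, Mor (G n) B) (p : forall n, Mor B (G n)),
    [/\ \sum_(n < N) i n ∘ p n = idm B,
        forall n, (n < N)%N -> p n ∘ i n = idm (G n),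
        forall n m, n != m -> p n ∘ i m = 0 &
        forall n, (N <= n)%N -> i n = 0 /\ p n = 0].
Proof.
elim: N => [|N [B [i [p [ip pi pi0 i0]]]]].
  exists (zobj C), (fun=> 0), (fun=> 0); split=> //.
    by rewrite big_ord0; apply/esym/zobj0.
  by move=> n m _; rewrite comp0m.
exists (B ⊕ G N).
exists (dfwith (fun n => inl_ B (G N) ∘ i n) (inr_ B (G N))).
exists (dfwith (fun n => p n ∘ prl_ B (G N)) (prr_ B (G N))).
split.
- rewrite big_ord_recr /= !dfwith_in -bip_id; congr (_ + _).
  rewrite -[inl_ _ _ in RHS]compm1 -ip comp_sumr comp_suml; apply: eq_bigr => n _.
  by rewrite !dfwith_out ?compA // gtn_eqF.
- move=> n; rewrite ltnS leq_eqVlt => /orP[/eqP -> | nN].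
    by rewrite !dfwith_in prr_inr.
  rewrite !dfwith_out ?gtn_eqF // -compA (compA (prl_ _ _)) prl_inl comp1m.
  exact: pi.
- move=> n m; have [<- | Nn] := eqVneq N n; have [<- | Nm] := eqVneq N m => //.
  + by move=> _; rewrite dfwith_in dfwith_out // compA prr_inl comp0m.
  + by move=> _; rewrite dfwith_in dfwith_out // -compA prl_inr compm0.
  + move=> nm; rewrite !dfwith_out // -compA (compA (prl_ _ _)) prl_inl comp1m.
    exact: pi0.
- move=> n Nn; rewrite !dfwith_out ?ltn_eqF //.
  by have [-> ->] := i0 _ (ltnW Nn); rewrite compm0 comp0m.
Qed.

Lemma ind_res_linear_sum (k : fieldType) (C : abelian_category k) (P : ind_object C)
    (A B : C) (x : P B) N (f : 'I_N -> Mor A B) :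
  ind_res P (\sum_i f i) x = \sum_i ind_res P (f i) x.
Proof.
have r0 : ind_res P (0 : Mor A B) x = 0.
  have := ind_res_linear_hom (i := P) x (-1) (0 : Mor A B) 0.
  by rewrite /= scaler0 addr0 scaleN1r addNr.
elim/big_rec2: _ => [//|i y f' _ <-].
by have := ind_res_linear_hom (i := P) x 1 (f i) f'; rewrite /= !scale1r.
Qed.

(** * Finiteness of the image of [Sym Y -> Sym X] *)

Section SymImage.
Variables (k : fieldType) (C : tensor_category k) (X Y : C) (j : Mor Y X).

(** If the image is represented by [B], its embedding is determined by one element [t] over [B], the
    image of [idm B]. This [t] has finite support, and by naturality each [Symm j n] is a
    restriction of the component of [t] at [n]. *)
Lemma sym_image_finite_vanish :
  sym_image_finite j -> exists N, forall n, (N <= n)%N -> Symm j n = 0.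
Proof.
move=> [S' [S [inj' [inj [u [I [e [m [_ Sco uE [_ _ meE] [B [a [b [ba _]]]]]]]]]]]]].
have [w [wE _]] := Sco _ (@ind_inj _ _ (Sym X)).
pose t : ind_sum (Sym X) B := w B (m B (b B (idm B))).
have [N tN] := fsum_fin t; exists N => n /tN tn.
pose g : Mor (Sym Y n) B := a _ (e _ (inj' n _ (idm (Sym Y n)))).
have E1 : w _ (m _ (b _ g)) = ind_res (ind_sum (Sym X)) g t.
  by rewrite /t -!ind_app_nat /= comp1m.
have E2 : w _ (m _ (b _ g)) = @ind_inj _ _ (Sym X) n _ (Symm j n).
  have -> : b _ g = e _ (inj' n _ (idm (Sym Y n))) := ba _ _.
  have -> : m _ (e _ (inj' n _ (idm (Sym Y n)))) = u _ (inj' n _ (idm _)) := meE _ _.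
  have -> : u _ (inj' n _ (idm (Sym Y n))) = inj n _ (Symm j n ∘ idm _) := uE n _ _.
  rewrite compm1; exact: wE n _ (Symm j n).
have := congr1 (fun x : ind_sum (Sym X) (Sym Y n) => fsum_val x n) E2.
by rewrite E1 /= single_diag tn comp0m.
Qed.

Variable N : nat.
Hypothesis jN : forall n, (N <= n)%N -> Symm j n = 0.

Let F := Sym Y.
Let G := Sym X.
Let I n := im (Symm j n).

Lemma sym_map_fin A (x : ind_sum F A) :
  exists M, forall n, (M <= n)%N -> Symm j n ∘ fsum_val x n = 0.
Proof. by have [M xM] := fsum_fin x; exists M => n /xM ->; rewrite compm0. Qed.

Definition sym_map_fun A (x : ind_sum F A) : ind_sum G A := FSum (sym_map_fin x).

Lemma sym_map_linear A : linear (@sym_map_fun A).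
Proof. by move=> a x y; apply: fsum_ext => n; rewrite /= compDr compZr. Qed.

Lemma sym_map_nat A B (f : Mor A B) x :
  sym_map_fun (ind_res (ind_sum F) f x) = ind_res (ind_sum G) f (sym_map_fun x).
Proof. by apply: fsum_ext => n; rewrite /= compA. Qed.

Definition sym_map : ind_hom (ind_sum F) (ind_sum G) := IndHom sym_map_linear sym_map_nat.

Lemma sym_image_finite_bounded : sym_image_finite j.
Proof.
have [B [i [p [ip pi pi0 i0]]]] := finite_biproduct I N.
pose e A (x : ind_sum F A) : yo B A := \sum_(n < N) i n ∘ (im_proj (Symm j n) ∘ fsum_val x n).
have e_lin A : linear (e A).
  move=> a x y; rewrite /e scaler_sumr -big_split; apply: eq_bigr => n _.
  by rewrite /= !(compDr, compZr).
have e_nat A A' (f : Mor A A') x : e A (ind_res (ind_sum F) f x) = ind_res (yo B) f (e A' x).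
  by rewrite /e /= comp_suml; apply: eq_bigr => n _; rewrite !compA.
have m_fin A (y : Mor A B) :
    exists M, forall n, (M <= n)%N -> im_incl (Symm j n) ∘ (p n ∘ y) = 0.
  by exists N => n /i0[_ ->]; rewrite comp0m compm0.
pose m A (y : yo B A) : ind_sum G A := FSum (m_fin A y).
have m_lin A : linear (m A).
  by move=> a x y; apply: fsum_ext => n; rewrite /= !(compDr, compZr).
have m_nat A A' (f : Mor A A') x : m A (ind_res (yo B) f x) = ind_res (ind_sum G) f (m A' x).
  by apply: fsum_ext => n; rewrite /= !compA.
exists (ind_sum F), (ind_sum G), (@ind_inj _ _ F), (@ind_inj _ _ G), sym_map, (yo B).
exists (IndHom e_lin e_nat), (IndHom m_lin m_nat); split.
- exact: ind_sum_coproduct.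
- exact: ind_sum_coproduct.
- move=> n A x; apply: fsum_ext => l /=; have [<- | nl] := eqVneq n l.
    by rewrite !single_diag.
  by rewrite !single_off // compm0.
- split=> [S v w vw A y | S v w vw A x | A x].
  (* A map out of [yo B] is determined by its value at [idm B], hence by the restrictions to the
     summands [I n]. As [im_proj] is by construction a cokernel, left exactness of [S] makes
     restriction along it injective, and there the two maps agree. *)
  + have resE (h : ind_hom (yo B) S) D (x : Mor D B) : h D x = ind_res S x (h B (idm B)).
      by rewrite -ind_app_nat /= comp1m.
    have eE n : (n < N)%N -> e _ (@ind_inj _ _ F n _ (idm _)) = i n ∘ im_proj (Symm j n).
      move=> nN; rewrite /e (bigD1 (Ordinal nN)) //= single_diag compm1 big1 ?addr0 // => l nl.
      by rewrite single_off ?compm0 // eq_sym.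
    have iE n : (n < N)%N -> ind_res S (i n) (v B (idm B)) = ind_res S (i n) (w B (idm B)).
      move=> nN; apply: (@ind_lex_inj _ _ S _ _ (kerm (Symm j n))).
      have := vw _ (@ind_inj _ _ F n _ (idm _)); rewrite /= eE // resE (resE w).
      by rewrite !ind_resM.
    have yE : y = \sum_(n < N) i n ∘ (p n ∘ y).
      rewrite -[LHS]comp1m -ip comp_suml; apply: eq_bigr => n _; exact/esym/compA.
    rewrite resE (resE w) yE !ind_res_linear_sum.
    by apply: eq_bigr => n _; rewrite !ind_resM iE.
  + have H := vw A x; rewrite -[LHS]comp1m -[RHS]comp1m -ip !comp_suml.
    apply: eq_bigr => n _; rewrite -!compA; congr (_ ∘ _).
    apply: (im_incl_mono (Symm j n)).
    exact: (congr1 (fun h : ind_sum G A => fsum_val h n) H).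
  + apply: fsum_ext => n /=; have [nN | Nn] := ltnP n N; last first.
      by have [_ ->] := i0 _ Nn; rewrite comp0m compm0 jN // comp0m.
    rewrite /e comp_sumr (bigD1 (Ordinal nN)) //= big1 => [|l nl].
      by rewrite addr0 (compA (p n)) pi // comp1m compA im_projE.
    by rewrite compA pi0 ?comp0m // eq_sym.
- by exists B, (ind_id _), (ind_id _).
Qed.

End SymImage.

(** * Tensor functors *)

Section Functor.
Variables (k : fieldType) (C D : pretannakian_category k) (F : tensor_functor C D).
Implicit Types A B T W X Y Z : C.

Lemma fmap0 X Y : fmap F (0 : Mor X Y) = 0.
Proof.
by have := fmap_linear F (-1) (0 : Mor X Y) 0; rewrite scaler0 addr0 scaleN1r addNr.
Qed.

Lemma fmapD X Y (f g : Mor X Y) : fmap F (f + g) = fmap F f + fmap F g.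
Proof. by have := fmap_linear F 1 f g; rewrite !scale1r. Qed.

Lemma fmapB X Y (f g : Mor X Y) : fmap F (f - g) = fmap F f - fmap F g.
Proof. by apply/eqP; rewrite eq_sym subr_eq -fmapD subrK. Qed.

Lemma fmap_epi X Y (f : Mor X Y) : is_epi f -> is_epi (fmap F f).
Proof. by move=> /ker_ses /(fmap_exact F) []. Qed.

(** Exactness is only assumed for short exact sequences, so [r] is first replaced by the inclusion
    of its image, which has the same cokernel. *)
Lemma fmap_cokerm X Y (r : Mor X Y) (W : D) (h : Mor (F Y) W) :
  h ∘ fmap F r = 0 -> exists h', h' ∘ fmap F (cokerm r) = h.
Proof.
move=> hr; have S : short_exact (im_incl r) (cokerm r).
  split; [exact: im_incl_mono | exact: cokerm_epi | |].
    by apply: (epi_eq0 (im_proj_epi r)); rewrite -compA im_projE cokerm0.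
  move=> T g rg; apply: mono_normal; first exact: im_incl_mono.
  have cr : cokerm (im_incl r) ∘ r = 0.
    have : cokerm (im_incl r) ∘ (im_incl r ∘ im_proj r) = 0 by rewrite compA cokerm0 comp0m.
    by rewrite im_projE.
  by rewrite -(coker_descE cr) -compA rg compm0.
apply: (ses_desc (fmap_exact F S)).
by apply: (epi_eq0 (fmap_epi (im_proj_epi r))); rewrite -compA -fmapM im_projE.
Qed.

Definition fmulV X Y : Mor (F (X ⊗ Y)) (F X ⊗ F Y) := sval (cid (fmul_iso F X Y)).

Lemma fmulK X Y : fmulV X Y ∘ fmul F X Y = idm _.
Proof. by rewrite /fmulV; case: cid => g []. Qed.

Lemma fmulVK X Y : fmul F X Y ∘ fmulV X Y = idm _.
Proof. by rewrite /fmulV; case: cid => g []. Qed.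

Lemma fmulV_iso X Y : is_iso (fmulV X Y).
Proof. by exists (fmul F X Y); rewrite fmulK fmulVK. Qed.

Lemma fmulV_nat X X' Y Y' (f : Mor X X') (g : Mor Y Y') :
  fmulV X' Y' ∘ fmap F (f ⊠ g) = (fmap F f ⊠ fmap F g) ∘ fmulV X Y.
Proof.
apply: (iso_epi (fmul_iso F X Y)).
by rewrite -!compA -fmul_nat fmulK compm1 compA fmulK comp1m.
Qed.

(** Rebracketing by [fmul_assoc] puts the two factors [X] together, where compatibility of [F] with
    the braiding applies. *)
Lemma fmap_tswap X Y :
  fmap F (tswap X Y) ∘ (fmul F X (X ⊗ Y) ∘ (idm _ ⊠ fmul F X Y)) =
  fmul F X (X ⊗ Y) ∘ (idm _ ⊠ fmul F X Y) ∘ tswap (F X) (F Y).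
Proof.
set N := fmul F (X ⊗ X) Y ∘ (fmul F X X ⊠ idm (F Y)).
have ME : fmul F X (X ⊗ Y) ∘ (idm _ ⊠ fmul F X Y) =
    fmap F (assoc X X Y) ∘ (N ∘ assocV (F X) (F X) (F Y)).
  by rewrite /N !compA fmul_assoc -!compA assocVK compm1.
have NE : N ∘ (braid (F X) (F X) ⊠ idm (F Y)) = fmap F (braid X X ⊠ idm Y) ∘ N.
  by rewrite /N -compA -tensMl -fmul_braid tensMl -fmap1 !compA fmul_nat.
clearbody N; have aK : fmap F (assocV X X Y) ∘ fmap F (assoc X X Y) = idm _.
  by rewrite -fmapM assocK fmap1.
rewrite ME /tswap !fmapM -!compA (compAE (assocK _ _ _)) comp1m (compAE NE) -!compA.
by rewrite (compAE aK) comp1m.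
Qed.

Section Power.
Variables (X : C) (g : Mor (F X) (tunit D)).

Fixpoint fpow n : Mor (F (tpow X n)) (tunit D) :=
  match n return Mor (F (tpow X n)) (tunit D) with
  | 0 => funitV F
  | n'.+1 => evl g (fpow n') ∘ fmulV X (tpow X n')
  end.

Lemma fpow_epi Z (z : Mor Z X) n :
  is_epi (g ∘ fmap F z) -> is_epi (fpow n ∘ fmap F (tpowm z n)).
Proof.
move=> gz; elim: n => [|n IHn] /=.
  by rewrite fmap1 compm1; apply: iso_epi; exists (funit F); rewrite funitVK funitK.
rewrite -compA fmulV_nat compA evl_tens; apply: epi_comp; last exact/iso_epi/fmulV_iso.
exact: evl_epi gz IHn.
Qed.

Lemma fpow_swap n i : fpow n ∘ fmap F (adj X n i) = fpow n.
Proof.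
elim: n i => [|n IHn] i; first by rewrite /= fmap1 compm1.
case: i => [|i]; last by rewrite /= -compA fmulV_nat compA evl_tens fmap1 compm1 IHn.
case: n {IHn} => [|n]; first by rewrite /= fmap1 compm1.
set Y := tpow X n; set M := fmul F X (X ⊗ Y) ∘ (idm _ ⊠ fmul F X Y).
have Mi : is_iso M.
  by apply: iso_comp (fmul_iso F _ _) _; apply: tens_iso (iso_id _) (fmul_iso F _ _).
have GM : fpow n.+2 ∘ M = evl g (evl g (fpow n)).
  rewrite [fpow _]/= /M compA -(compA (evl _ _)) fmulK compm1 evl_tens compm1.
  by rewrite -compA fmulK compm1.
apply: (iso_epi Mi); rewrite GM -compA.
have -> : fmap F (adj X n.+2 0) ∘ M = M ∘ gswap (F X) (F X) (F Y) := fmap_tswap X Y.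
by rewrite compA GM evl_evl_swap.
Qed.

Lemma fmap_kills_sym_rk0 Z (z : Mor Z X) n : sym_rk z n = 0%N -> g ∘ fmap F z = 0.
Proof.
move/rk_eq0 => zn; apply: contrapT => /nonzero_to_unit /(fpow_epi (n := n)).
have fpow_swaps s : swaps s -> fpow n ∘ fmap F s = fpow n.
  elim=> [|i {}s _ IH]; first by rewrite fmap1 compm1.
  by rewrite fmapM compA fpow_swap.
have [|h hE] := @fmap_cokerm _ _ (sym_rel X n) _ (fpow n).
  suff : forall l : seq 'S_n, fpow n ∘
      fmap F (dsum_copair (fun s : 'S_n => tperm_act X s - idm _) l) = 0 by apply.
  elim=> [|s l IHl] /=; first by rewrite fmap0 compm0.
  rewrite fmapD compDr !fmapM (compA _ _ (fmap F (prr_ _ _))) IHl comp0m addr0.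
  rewrite fmapB compA compBr fmap1 compm1 fpow_swaps ?subrr ?comp0m //.
  exact: swaps_tperm_act.
move/epi_to_unit_neq0; apply.
by rewrite -hE -compA -fmapM -/(symq X n) zn fmap0 compm0.
Qed.

End Power.

Lemma hom_unit_map_linear X : linear (@hom_unit_map _ _ _ F X).
Proof. by move=> a f g; rewrite /hom_unit_map fmap_linear compDr compZr. Qed.

Lemma funitV_iso : is_iso (funitV F).
Proof. by exists (funit F); rewrite funitVK funitK. Qed.

(** A nonzero map to the unit is epi, exact functors preserve epis, and an epi to the unit is
    nonzero. *)
Lemma hom_unit_map_inj X : injective (@hom_unit_map _ _ _ F X).
Proof.
move=> f g fg; apply: subr0_eq; apply: contrapT.
move=> /nonzero_to_unit /fmap_epi fe; apply: (epi_to_unit_neq0 (f := hom_unit_map F (f - g))).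
  exact: epi_comp (iso_epi funitV_iso) fe.
by rewrite /hom_unit_map fmapB compBr -!/(hom_unit_map F _) fg subrr.
Qed.

(** Exactness and [F 1 = 1] carry flags to flags. Completeness need not be preserved; it follows
    when some [sym_rk z n] vanishes. *)
Lemma flag_fmap X Z (z : Mor Z X) s :
  flag z s -> flag (fmap F z) [seq hom_unit_map F f | f <- s].
Proof.
elim=> [|{}Z W {}z w f {}s _ IH wf]; first by rewrite fmap1; apply: flag_nil.
rewrite fmapM; apply: flag_cons IH _.
have [wm fe fw lift] := fmap_exact F wf.
have fE : hom_unit_map F f ∘ fmap F z = funitV F ∘ fmap F (f ∘ z).
  by rewrite /hom_unit_map -compA -fmapM.
rewrite fE; split=> //; first exact: epi_comp (iso_epi funitV_iso) fe.
  by rewrite -compA fw compm0.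
move=> T g; rewrite -compA => fg; apply: lift.
exact: (mono_eq0 (iso_mono funitV_iso) fg).
Qed.

Section Conclusion.
Variables (X Z : C) (z : Mor Z X) (s : seq (Mor X (tunit C))) (n : nat).
Hypotheses (zs : flag z s) (zn : sym_rk z n = 0%N).

Lemma dimk_fmap (R : realType) : dimk (Mor (F X) (tunit D)) R = ((size s)%:R)%:E.
Proof.
rewrite (complete_dimk R (flag_fmap zs)) ?size_map // => g.
exact: fmap_kills_sym_rk0 zn.
Qed.

(** Every [g] kills [fmap F z], so it lies in the span of the image flag, whose members come from
    maps on [X]. *)
Lemma hom_unit_map_bij : bijective (@hom_unit_map _ _ _ F X).
Proof.
have surj (g : Mor (F X) (tunit D)) : exists f, hom_unit_map F f = g.
  have [c ->] := flag_span (flag_fmap zs) (fmap_kills_sym_rk0 g zn).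
  exists (\sum_(i < size s) c i *: s`_i).
  have hom0 : hom_unit_map F (0 : Mor X _) = 0 by rewrite /hom_unit_map fmap0 compm0.
  rewrite size_map; elim/big_rec2: _ => [//|i f' f _ <-].
  by rewrite hom_unit_map_linear (nth_map 0).
exists (fun g => sval (cid (surj g))) => [f | g]; last by case: cid.
by apply: hom_unit_map_inj; case: cid.
Qed.

End Conclusion.

End Functor.

Section Identity.
Variables (k : fieldType) (C : tensor_category k).

(** Specializes condition (2) to condition (1). *)
Definition id_functor : tensor_functor C C.
Proof.
refine (@TensorFunctor k C C (fun X => X) (fun X Y f => f) _ _ _ _
  (fun X Y => idm (X ⊗ Y)) _ _ (idm _) (idm _) _ _ _ _ _ _) => //.
- by move=> X Y; apply: iso_id.
- by move=> X X' Y Y' f g; rewrite comp1m compm1.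
- exact: comp1m.
- exact: comp1m.
- by move=> X Y Z; rewrite !tensm1 !compm1 comp1m.
- by move=> X; rewrite tensm1 !compm1.
- by move=> X; rewrite tensm1 !compm1.
- by move=> X Y; rewrite compm1 comp1m.
Defined.

End Identity.

Theorem proposition7p2p1 (R : realType) (k : closedFieldType)
    (C : pretannakian_category k) (X : C) :
  [/\ (dimk (Mor X (tunit C)) R <= sgd R X)%E,
      dimk (Mor X (tunit C)) R = sgd R X <->
        (forall (D : pretannakian_category k) (F : tensor_functor C D),
           dimk (Mor (F X) (tunit D)) R = sgd R X),
      dimk (Mor X (tunit C)) R = sgd R X <-> tilde_image_finite X &
      (forall (D : pretannakian_category k) (F : tensor_functor C D),
         dimk (Mor (F X) (tunit D)) R = sgd R X) ->
      forall (D : pretannakian_category k) (F : tensor_functor C D),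
        bijective (fun f : Mor X (tunit C) => hom_unit_map F f)].
Proof.
have [Z [z [s [zs zc]]]] := complete_flag X.
have dimE := complete_dimk R zs zc.
(* All conditions are compared with the vanishing of one [sym_rk z n], for a fixed complete flag. *)
have eqP1 : dimk (Mor X (tunit C)) R = sgd R X <-> exists n, sym_rk z n = 0%N.
  by rewrite dimE; apply: sgd_eqP zs.
have eq2_1 : (forall (D : pretannakian_category k) (F : tensor_functor C D),
    dimk (Mor (F X) (tunit D)) R = sgd R X) -> exists n, sym_rk z n = 0%N.
  by move=> /(_ C (id_functor C)) /eqP1.
split.
- by rewrite dimE; apply: sgd_ge zs.
- split=> [/[dup] E /eqP1[n zn] D F | /eq2_1 /eqP1 //].
  by rewrite (dimk_fmap F zs zn) -dimE.
- split=> [/eqP1[n zn] | [n [e [eb fin]]]].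
    exists (size s), (fun i : 'I_(size s) => s`_i).
    have eb := complete_basis zs zc; split=> //.
    have [Z' [z' [zs' zc' zz']]] := flag_tilde eb.
    (* The flag [z'] built from the basis may differ from [z]; the vanishing is carried over through
       the equality with [sgd], which does not mention a flag. *)
    have [N NP] : exists N, sym_rk z' N = 0%N.
      apply: (sgd_eqP R zs').1; rewrite -(complete_dimk R zs' zc').
      by apply/eqP1; exists n.
    apply: (@sym_image_finite_bounded _ _ _ _ _ N) => m Nm.
    apply/sym_rk_eq0; rewrite -zz'.
    elim: m Nm => [|m IHm]; first by rewrite leqn0 => /eqP N0; rewrite N0 in NP.
    by rewrite leq_eqVlt => /orP[/eqP <- //|/IHm]; apply: sym_rk_eq0S.
  have [Z' [z' [zs' zc' zz']]] := flag_tilde eb.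
  rewrite (complete_dimk R zs' zc'); apply/(sgd_eqP R zs').
  have [N NP] := sym_image_finite_vanish fin; exists N.
  by rewrite zz'; apply/sym_rk_eq0/NP.
- move=> /eq2_1[n zn] D F; exact: hom_unit_map_bij zs zn.
Qed.
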